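(* Let $\vec a,\vec b,\vec c\in\mathbb{R}^2$. Then the following are equivalent: (1) $S_{\vec a,\vec b,\vec c}$ is bounded from $L^\infty(T_B\times T_B)$ to $L^\infty(T_B\times T_B)$; (2) $T_{\vec a,\vec b,\vec c}$ is bounded from $L^\infty(T_B\times T_B)$ to $L^\infty(T_B\times T_B)$; (3) for each $i\in\{1,2\}$: $a_i>0$, $b_i>-1$, and $c_i=n+1+a_i+b_i$.
   Context: Let $n$ be a positive integer. For $z=(z_1,\dots,z_n)\in\mathbb{C}^n$ write $z=x+iy$ with $x,y\in\mathbb{R}^n$, $z'=(z_1,\dots,z_{n-1})$, $y'=(y_1,\dots,y_{n-1})$. Let $B=\{y\in\mathbb{R}^n: |y'|^2<y_n\}$ and $T_B=\{x+iy: x\in\mathbb{R}^n, y\in B\}$. For $z\in T_B$ put $\rho(z)=y_n-|y'|^2>0$, and for $z,u\in T_B$ put $\rho(z,u)=\frac14\big(\sum_{j=1}^{n-1}(z_j-\overline{u_j})^2-2i(z_n-\overline{u_n})\big)$; this has positive real part, and complex powers $\rho(z,u)^c$ are taken with the principal branch. $dV$ is Lebesgue measure on $\mathbb{C}^n$. $L^\infty(T_B\times T_B)$ is the space of essentially bounded measurable functions on $T_B\times T_B$. For $\vec a=(a_1,a_2),\vec b=(b_1,b_2),\vec c=(c_1,c_2)\in\mathbb{R}^2$, $T_{\vec a,\vec b,\vec c}f(z,w)=\rho(z)^{a_1}\rho(w)^{a_2}\int_{T_B}\int_{T_B}\frac{\rho(u)^{b_1}\rho(\eta)^{b_2}}{\rho(z,u)^{c_1}\rho(w,\eta)^{c_2}}f(u,\eta)\,dV(u)\,dV(\eta)$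 and $S_{\vec a,\vec b,\vec c}f(z,w)=\rho(z)^{a_1}\rho(w)^{a_2}\int_{T_B}\int_{T_B}\frac{\rho(u)^{b_1}\rho(\eta)^{b_2}}{|\rho(z,u)|^{c_1}|\rho(w,\eta)|^{c_2}}f(u,\eta)\,dV(u)\,dV(\eta)$. An operator is bounded from $X$ to $Y$ if for every $f\in X$ the defining integral converges for a.e. $(z,w)$ and $\|Tf\|_Y\le C\|f\|_X$ with $C$ independent of $f$. *)

(* Defs.v *)
From HB Require Import structures.
From mathcomp Require Import all_boot all_order all_algebra.
From mathcomp Require Import all_classical all_reals all_analysis.
From mathcomp.real_closed Require Import complex.
Set Implicit Arguments. Unset Strict Implicit. Unset Printing Implicit Defensive.
Import Order.TTheory GRing.Theory Num.Theory.
Import numFieldNormedType.Exports.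
Local Open Scope classical_set_scope.
Local Open Scope ring_scope.
Local Open Scope complex_scope.

(* A point z of C^n is an n-tuple of pairs (x_j, y_j), z_j = x_j + i y_j.
   Coordinates are indexed 0..n-1; z' = the first n-1 coordinates, and the
   last coordinate z_n has index n.-1. *)
Definition Cn (R : realType) (n : nat) := n.-tuple (R * R).

Section Defs.
Variables (R : realType) (n : nat).

Definition xco (z : Cn R n) (j : nat) : R := (nth (0, 0) z j).1.
Definition yco (z : Cn R n) (j : nat) : R := (nth (0, 0) z j).2.
Definition zco (z : Cn R n) (j : nat) : R[i] := Complex (xco z j) (yco z j).

(* rho(z) = y_n - |y'|^2 *)
Definition rho (z : Cn R n) : R :=
  yco z n.-1 - \sum_(j < n.-1) yco z j ^+ 2.

(* T_B = { x + i y : |y'|^2 < y_n } *)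
Definition TB : set (Cn R n) := [set z | \sum_(j < n.-1) yco z j ^+ 2 < yco z n.-1].

(* rho(z,u) = 1/4 ( sum_{j<n} (z_j - conj u_j)^2 - 2 i (z_n - conj u_n) ) *)
Definition rho2 (z u : Cn R n) : R[i] :=
  (4%:R)^-1%:C * (\sum_(j < n.-1) (zco z j - (zco u j)^*) ^+ 2
                  - 2%:R%:C * 'i * (zco z n.-1 - (zco u n.-1)^*)).

(* modulus of a complex number *)
Definition cabs (w : R[i]) : R := Num.sqrt (complex.Re w ^+ 2 + complex.Im w ^+ 2).

(* principal argument, in (-pi, pi] *)
Definition Arg (w : R[i]) : R :=
  let a := complex.Re w in let b := complex.Im w in
  if 0 < a then atan (b / a)
  else if a < 0 then (if 0 <= b then atan (b / a) + pi else atan (b / a) - pi)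
  else if 0 < b then pi / 2 else if b < 0 then - (pi / 2) else 0.

(* principal branch w^c = exp(c Log w), Log w = ln|w| + i Arg w (w <> 0) *)
Definition cpow (w : R[i]) (c : R) : R[i] :=
  (expR (c * ln (cabs w)))%:C * Complex (cos (c * Arg w)) (sin (c * Arg w)).

End Defs.

Section Operators.
Variables (R : realType) (n : nat).
Local Notation P := (Cn R n * Cn R n)%type.

(* kernel of T_{a,b,c}: (z,w),(u,eta) |-> rho(z)^a1 rho(w)^a2 rho(u)^b1 rho(eta)^b2
   / (rho(z,u)^c1 rho(w,eta)^c2) *)
Definition kerT (a b c : R * R) (p q : P) : R[i] :=
  ((rho p.1 `^ a.1 * rho p.2 `^ a.2 * rho q.1 `^ b.1 * rho q.2 `^ b.2)%:C)
  / (cpow (rho2 p.1 q.1) c.1 * cpow (rho2 p.2 q.2) c.2).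

(* kernel of S_{a,b,c}: same with |rho(z,u)|^c1 |rho(w,eta)|^c2 *)
Definition kerS (a b c : R * R) (p q : P) : R[i] :=
  ((rho p.1 `^ a.1 * rho p.2 `^ a.2 * rho q.1 `^ b.1 * rho q.2 `^ b.2)
   / (cabs (rho2 p.1 q.1) `^ c.1 * cabs (rho2 p.2 q.2) `^ c.2))%:C.

Variable mu : {sigma_finite_measure set Cn R n -> \bar R}.
Local Notation mu2 := (mu \x mu)%E.
Local Notation D := (@TB R n `*` @TB R n).

(* the integral operator with kernel K applied to f, evaluated at p
   (real and imaginary parts integrated separately over T_B x T_B) *)
Definition intop (K : P -> P -> R[i]) (f : P -> R[i]) (p : P) : R[i] :=
  Complex (Rintegral mu2 D (fun q => complex.Re (K p q * f q)))
          (Rintegral mu2 D (fun q => complex.Im (K p q * f q))).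

(* f is (Lebesgue) measurable on T_B x T_B *)
Definition cmeasurable (f : P -> R[i]) : Prop :=
  measurable_fun D (fun q => complex.Re (f q)) /\
  measurable_fun D (fun q => complex.Im (f q)).

(* |f| <= M almost everywhere on T_B x T_B, i.e. ||f||_oo <= M *)
Definition ae_bounded (f : P -> R[i]) (M : R) : Prop :=
  {ae mu2, forall q, D q -> cabs (f q) <= M}.

(* f in L^oo(T_B x T_B) *)
Definition Linf (f : P -> R[i]) : Prop :=
  cmeasurable f /\ exists M : R, ae_bounded f M.

(* the integral defining (K f)(p) converges (absolutely) *)
Definition converges_at (K : P -> P -> R[i]) (f : P -> R[i]) (p : P) : Prop :=
  mu2.-integrable D (fun q => (complex.Re (K p q * f q))%:E) /\
  mu2.-integrable D (fun q => (complex.Im (K p q * f q))%:E).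

(* the integral operator with kernel K is bounded L^oo -> L^oo:
   for every f in L^oo, the integral converges a.e., Kf is measurable,
   and ||Kf||_oo <= C ||f||_oo *)
Definition bounded_Linf (K : P -> P -> R[i]) : Prop :=
  exists C : R, forall f : P -> R[i], Linf f ->
    {ae mu2, forall p, D p -> converges_at K f p} /\
    cmeasurable (intop K f) /\
    (forall M : R, ae_bounded f M -> ae_bounded (intop K f) (C * M)).

End Operators.

(* mu is Lebesgue measure on C^n = R^{2n}: measure of every closed box
   prod_j ([lo_j.1, hi_j.1] x [lo_j.2, hi_j.2]) is the product of side lengths.
   (This determines mu uniquely on the product Borel sigma-algebra.) *)
Definition is_lebesgue (R : realType) (n : nat)
  (mu : {measure set Cn R n -> \bar R}) : Prop :=
  forall lo hi : 'I_n -> R * R,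
    (forall j, (lo j).1 <= (hi j).1 /\ (lo j).2 <= (hi j).2) ->
    mu [set z : Cn R n | forall j : 'I_n,
          (lo j).1 <= (tnth z j).1 <= (hi j).1 /\ (lo j).2 <= (tnth z j).2 <= (hi j).2]
    = (\prod_(j < n) (((hi j).1 - (lo j).1) * ((hi j).2 - (lo j).2)))%:E.

(* Main.v *)
(* Writing z = x + i y and u = s + i t, one finds
     Re rho(z,u) = (rho(z) + rho(u))/2 + |z' - u'|^2/4,
     Im rho(z,u) = ((x'-s').(y'+t') - (x_n - s_n))/2.
   Put I(z) = int_{T_B} rho(u)^b |rho(z,u)|^(-c) dV(u).  Integrating the last
   coordinate first (t_n, then s_n, both up to a translation depending on u') and
   then the coordinates of u' one by one gives I(z) <= K rho(z)^(-a) under (3).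
   Since c is real, |rho(z,u)^c| = |rho(z,u)|^c, so the kernels of S and T have the
   same modulus and differ by a phase; hence (3) implies (1) and (2).

   Conversely, on boxes of size sqrt t in z' and t in z_n around (0, i t) the phase
   is close to 0 and |rho(z,u)| has order t.  Testing the operator on indicators
   of products of two such boxes of sizes t1, t2 shows that
   t1^(a1+b1-c1+n+1) t2^(a2+b2-c2+n+1) stays bounded, so both exponents vanish.
   Testing on f = 1 gives I_1(z) I_2(w) < oo at some point; but I = oo when b <= -1
   (already along each vertical fibre, near the boundary) and when
   c <= n + 1 + b (sum over the disjoint boxes of sizes 4^k). *)
Require Import Defs.
From HB Require Import structures.
From mathcomp Require Import all_boot all_order all_algebra.
From mathcomp Require Import all_classical all_reals all_analysis measurable_realfun.
From mathcomp.real_closed Require Import complex.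
From mathcomp Require Import ring lra.
Set Implicit Arguments. Unset Strict Implicit. Unset Printing Implicit Defensive.
Import Order.TTheory GRing.Theory Num.Theory.
Import numFieldNormedType.Exports.
Local Open Scope classical_set_scope.
Local Open Scope ring_scope.

(** The hypothesis on [mu] only gives measures of boxes, while the upper estimate needs iterated
    integrals; so [mu] is identified, by uniqueness on a pi-system, with the image of a product
    measure on C^m x R x R, where n = m + 1.

    Both operators are treated as one: the kernel is a nonnegative modulus times exp(i th), with th
    = 0 for S and |th| controlled by |c1|, |c2| and the two arguments for T. The upper bound sees
    only the modulus. In the lower bounds the danger is cancellation in T. On the test boxes the
    phase stays below 1, so the real part of the kernel is at least cos 1 times its modulus; for f =
    1 the convergence is absolute, so the phase drops out.

    The boxes follow the dilations (z', z_n) -> (sqrt t z', t z_n), under which rho is homogeneous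
    of degree 1 and volume of degree n + 1. A bound valid for all t > 0, small and large, leaves
    only the exponent 0. The resulting identity turns c <= n + 1 + b into a <= 0, so the two
    divergences of I(z) yield the two inequalities of (3). *)

Section sigma_finite_product.
Local Open Scope ereal_scope.
Context d1 d2 (T1 : measurableType d1) (T2 : measurableType d2) (R : realType).
Variable m1 : {sigma_finite_measure set T1 -> \bar R}.
Variable m2 : {sigma_finite_measure set T2 -> \bar R}.

(* The library's sigma-finite structure on [m1 \x m2] is shadowed by the one for
   subprobabilities; this alias carries its own. *)
Definition sfprod : set (T1 * T2) -> \bar R := m1 \x m2.

HB.instance Definition _ := Measure.copy sfprod (m1 \x m2).

Let sfprod_sigma_finite : sigma_finite setT sfprod.
Proof.
have /sigma_finiteP[F [TF ndF Foo]] := sigma_finiteT m1.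
have /sigma_finiteP[G [TG ndG Goo]] := sigma_finiteT m2.
exists (fun n => F n `*` G n).
  apply/esym; rewrite -subTset => -[x y] _.
  have [n _ Fnx] : (\bigcup_n F n) x by rewrite -TF.
  have [k _ Gky] : (\bigcup_n G n) y by rewrite -TG.
  exists (maxn n k) => //; split => /=.
    by move: x Fnx; exact/subsetPset/ndF/leq_maxl.
  by move: y Gky; exact/subsetPset/ndG/leq_maxr.
move=> k; have [? ?] := Foo k; have [? ?] := Goo k.
split; first exact: measurableX.
by rewrite [ltLHS]product_measure1E// lte_mul_pinfty// ge0_fin_numE.
Qed.

HB.instance Definition _ := Measure_isSigmaFinite.Build _ _ _ sfprod
  sfprod_sigma_finite.

End sigma_finite_product.

(** * Lebesgue measure on C^n: uniqueness, existence, iterated integration *)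

Section lebesgue_tuple.
Variable R : realType.
Local Open Scope ereal_scope.

(** Convertible to the set in [is_lebesgue], so that this hypothesis rewrites the measure of a box
    directly. *)
Definition cbox n (lo hi : 'I_n -> R * R) : set (Cn R n) :=
  [set z | forall j : 'I_n, ((lo j).1 <= (tnth z j).1 <= (hi j).1 /\
                            (lo j).2 <= (tnth z j).2 <= (hi j).2)%R].

Lemma measurable_cbox n lo hi : measurable (@cbox n lo hi).
Proof.
rewrite (_ : cbox lo hi = \bigcap_(j in [set: 'I_n])
  ((fun z : Cn R n => tnth z j) @^-1`
     (`[(lo j).1, (hi j).1]%classic `*` `[(lo j).2, (hi j).2]%classic))); last first.
  apply/seteqP; split => z /= zb j; rewrite ?in_itv/=; first by move=> _; exact: zb.
  by have := zb j Logic.I; rewrite /= !in_itv.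
apply: fin_bigcap_measurable => //.
move=> j _; rewrite -[X in measurable X]setTI.
apply: measurable_tnth => //; exact: measurableX.
Qed.

Definition cboxes n : set (set (Cn R n)) :=
  [set A | exists lo hi, A = @cbox n lo hi].
Arguments cboxes : clear implicits.

Definition cube n (k : nat) : set (Cn R n) :=
  cbox (fun _ => (- k%:R, - k%:R)%R) (fun _ => (k%:R, k%:R)%R).
Arguments cube : clear implicits.

Lemma cube_cover n : \bigcup_k cube n k = setT.
Proof.
rewrite -subTset => z _.
pose M := (\sum_(j < n) (`|(tnth z j).1| + `|(tnth z j).2|))%R.
have MP j : (`|(tnth z j).1| + `|(tnth z j).2| <= M)%R.
  by rewrite /M (bigD1 j)//= lerDl sumr_ge0// => i _; rewrite addr_ge0.
exists (Num.truncn M).+1 => // j /=.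
have lt : (M < (Num.truncn M).+1%:R)%R by exact: truncnS_gt.
have := MP j; move: lt; move: ((Num.truncn M).+1%:R) => K lt.
have := normr_ge0 (tnth z j).1; have := normr_ge0 (tnth z j).2.
move=> h2 h1 h; rewrite -!ler_norml; split; lra.
Qed.

(** Half-lines generate the Borel sets of R, so these half-spaces are what the generated
    sigma-algebra has to contain. Side [i] starts at [a]; all other sides grow with [k]. *)
Lemma cube_fst n (i : 'I_n) (a : R) : [set z : Cn R n | (a <= (tnth z i).1)%R] =
  \bigcup_k cbox (fun j => (if j == i then a else - k%:R, - k%:R)%R)
                 (fun=> (k%:R, k%:R)%R).
Proof.
apply/seteqP; split => z /=.
  move=> az; have : (\bigcup_k cube n k) z by rewrite cube_cover.
  move=> [k _ zk]; exists k => // j; have [] := zk j => /= /andP[h1 h2] h3.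
  by rewrite h2 andbT; split => //; case: eqVneq => [->|].
by move=> [k _ /(_ i)]; rewrite /= eqxx => -[/andP[]].
Qed.

Lemma cube_snd n (i : 'I_n) (a : R) : [set z : Cn R n | (a <= (tnth z i).2)%R] =
  \bigcup_k cbox (fun j => (- k%:R, if j == i then a else - k%:R)%R)
                 (fun=> (k%:R, k%:R)%R).
Proof.
apply/seteqP; split => z /=.
  move=> az; have : (\bigcup_k cube n k) z by rewrite cube_cover.
  move=> [k _ zk]; exists k => // j; have [] := zk j => /= h3 /andP[h1 h2].
  by rewrite h2 andbT; split => //; case: eqVneq => [->|].
by move=> [k _ /(_ i)]; rewrite /= eqxx => -[_ /andP[]].
Qed.

(** The inclusion that is not immediate says that the identity, from the space with the
    sigma-algebra generated by boxes, is measurable; this is checked on each real coordinate, where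
    the preimages are half-spaces. *)
Lemma measurable_cboxes n : @measurable _ (Cn R n) = <<s cboxes n >>.
Proof.
rewrite eqEsubset; split; last first.
  apply: smallest_sub; first exact: sigma_algebra_measurable.
  by move=> _ [lo [hi ->]]; exact: measurable_cbox.
pose T' := g_sigma_algebraType (cboxes n).
have mid : measurable_fun [set: T'] (id : T' -> Cn R n).
  apply/measurable_fun_tnthP => i.
  rewrite (_ : _ \o _ = fun z : T' =>
    ((tnth (z : Cn R n) i).1, (tnth (z : Cn R n) i).2)); last first.
    by apply/funext => z /=; case: (tnth _ _).
  apply: measurable_fun_pair.
  - apply: (measurability _ (RGenCInfty.measurableE R)) => _ [_ [a ->] <-].
    rewrite setTI (_ : _ @^-1` _ = [set z : Cn R n | (a <= (tnth z i).1)%R]); last first.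
      by apply/seteqP; split => z /=; rewrite in_itv/= andbT.
    rewrite cube_fst; apply: bigcupT_measurable => k.
    by apply: sub_sigma_algebra; eexists; eexists; reflexivity.
  - apply: (measurability _ (RGenCInfty.measurableE R)) => _ [_ [a ->] <-].
    rewrite setTI (_ : _ @^-1` _ = [set z : Cn R n | (a <= (tnth z i).2)%R]); last first.
      by apply/seteqP; split => z /=; rewrite in_itv/= andbT.
    rewrite cube_snd; apply: bigcupT_measurable => k.
    by apply: sub_sigma_algebra; eexists; eexists; reflexivity.
by move=> A mA; have := mid measurableT _ mA; rewrite setTI.
Qed.

Lemma cboxes_setI n : setI_closed (cboxes n).
Proof.
move=> _ _ [l1 [h1 ->]] [l2 [h2 ->]].
exists (fun j => (Num.max (l1 j).1 (l2 j).1, Num.max (l1 j).2 (l2 j).2)).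
exists (fun j => (Num.min (h1 j).1 (h2 j).1, Num.min (h1 j).2 (h2 j).2)).
apply/seteqP; split => z /=.
  move=> [z1 z2] j; have [/andP[? ?] /andP[? ?]] := z1 j; have [/andP[? ?] /andP[? ?]] := z2 j.
  by rewrite /= !ge_max !le_min; split; apply/andP; split; apply/andP.
move=> zz; split => j; have := zz j; rewrite /= !ge_max !le_min;
by move=> [/andP[/andP[? ?] /andP[? ?]] /andP[/andP[? ?] /andP[? ?]]]; split; apply/andP.
Qed.

Lemma is_lebesgue_cube n (mu : {measure set Cn R n -> \bar R}) k :
  is_lebesgue mu -> mu (cube n k) < +oo.
Proof.
move=> mul; rewrite [X in X < _](mul (fun _ => (- k%:R, - k%:R)%R)
  (fun _ => (k%:R, k%:R)%R)) ?ltry//.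
have k0 : (0 <= k%:R :> R)%R by [].
by move=> j /=; split; lra.
Qed.

Lemma is_lebesgue_unique n (m1 m2 : {measure set Cn R n -> \bar R}) :
  is_lebesgue m1 -> is_lebesgue m2 -> forall A, measurable A -> m1 A = m2 A.
Proof.
move=> l1 l2; apply: (measure_unique (cboxes n) (cube n)).
- exact: measurable_cboxes.
- exact: cboxes_setI.
- by move=> k; eexists; eexists; reflexivity.
- exact: cube_cover.
- move=> _ [lo [hi ->]].
  have [h|] := pselect (forall j, ((lo j).1 <= (hi j).1 /\ (lo j).2 <= (hi j).2)%R).
    by rewrite [LHS]l1// [RHS]l2.
  (* [is_lebesgue] says nothing about a box with reversed end points, but such a box is empty. *)
  move=> nh; rewrite (_ : cbox lo hi = set0) ?measure0//.
  apply/seteqP; split => z //= zb; apply: nh => j.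
  have [/andP[? ?] /andP[? ?]] := zb j; split.
    exact: (@le_trans _ _ (tnth z j).1).
  exact: (@le_trans _ _ (tnth z j).2).
- by move=> k; exact: is_lebesgue_cube.
Qed.

Lemma is_lebesgue_sigma_finite n (m : {measure set Cn R n -> \bar R}) :
  is_lebesgue m -> sigma_finite setT m.
Proof.
move=> ml; exists (cube n); first by rewrite cube_cover.
by move=> k; split; [exact: measurable_cbox|exact: is_lebesgue_cube].
Qed.

Local Notation leb := (@lebesgue_measure R).
Local Notation RR := (measurableTypeR R).

(** Appending at the end makes [q.1] the z' part of the point and [q.2] its coordinate z_n. *)
Definition snocC m (q : Cn R m * (RR * RR)) : Cn R m.+1 := rcons_tuple q.1 (q.2 : R * R).

Lemma tnth_snocC_lt m (q : Cn R m * (RR * RR)) (j : 'I_m) :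
  tnth (snocC q) (widen_ord (leqnSn m) j) = tnth q.1 j.
Proof.
rewrite /snocC !(tnth_nth (0, 0)%R)/= nth_rcons size_tuple ltn_ord.
by [].
Qed.

Lemma tnth_snocC_max m (q : Cn R m * (RR * RR)) :
  tnth (snocC q) ord_max = (q.2 : R * R).
Proof. by rewrite (tnth_nth (0, 0)%R)/= nth_rcons size_tuple ltnn eqxx. Qed.

Lemma measurable_snocC m : measurable_fun setT (@snocC m).
Proof.
apply/measurable_fun_tnthP => i.
have [[j ->]|->] : (exists j : 'I_m, i = widen_ord (leqnSn m) j) \/ i = ord_max.
- have [im|] := ltnP i m; first by left; exists (Ordinal im); exact/val_inj.
  move=> mi; right; apply/val_inj => /=; apply/eqP.
  by rewrite eqn_leq mi andbT -ltnS.
- rewrite (_ : _ \o _ = fun q => tnth q.1 j); last first.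
    by apply/funext => q /=; rewrite tnth_snocC_lt.
  exact: (measurableT_comp (measurable_tnth j)).
- rewrite (_ : _ \o _ = fun q => (q.2.1 : R, q.2.2 : R)); last first.
    by apply/funext => q /=; rewrite tnth_snocC_max; case: q.2.
  apply: measurable_fun_pair.
    exact: (measurableT_comp (@measurable_fst _ _ RR RR)).
  exact: (measurableT_comp (@measurable_snd _ _ RR RR)).
Qed.

Lemma cbox_snocC m (lo hi : 'I_m.+1 -> R * R) :
  @snocC m @^-1` cbox lo hi =
  cbox (fun j => lo (widen_ord (leqnSn m) j)) (fun j => hi (widen_ord (leqnSn m) j)) `*`
  (`[(lo ord_max).1, (hi ord_max).1]%classic `*` `[(lo ord_max).2, (hi ord_max).2]%classic).
Proof.
apply/seteqP; split => -[v [x y]] /=.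
  move=> h; split => [j|]; first by have := h (widen_ord (leqnSn m) j); rewrite tnth_snocC_lt.
  by have := h ord_max; rewrite tnth_snocC_max /= !in_itv.
rewrite !in_itv /= => -[h1 h2] j.
have [jm|mj] := ltnP j m.
  have -> : j = widen_ord (leqnSn m) (Ordinal jm) by exact/val_inj.
  by rewrite tnth_snocC_lt; exact: h1.
have -> : j = ord_max by apply/val_inj/eqP; rewrite /= eqn_leq mj andbT -ltnS.
by rewrite tnth_snocC_max.
Qed.

Definition snoc_measure m (nu : {sigma_finite_measure set Cn R m -> \bar R}) :
    set (Cn R m.+1) -> \bar R :=
  pushforward (nu \x (sfprod leb leb)) (@snocC m).

Section snoc_measure.
Variables (m : nat) (nu : {sigma_finite_measure set Cn R m -> \bar R}).

Let M : {measure set Cn R m.+1 -> \bar R} :=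
  measure_function_pushforward__canonical__measure_function_Measure
    (nu \x sfprod leb leb) (@measurable_snocC m).

HB.instance Definition _ := isMeasure.Build _ _ _ (snoc_measure nu)
  (measure0 M) (measure_ge0 M) (@measure_semi_sigma_additive _ _ _ M).

Lemma is_lebesgue_snoc_measure : is_lebesgue nu -> is_lebesgue (snoc_measure nu).
Proof.
move=> nul lo hi lohi; have := cbox_snocC lo hi.
rewrite /= /snoc_measure /pushforward /cbox => ->.
rewrite [LHS]product_measure1E; [|exact: measurable_cbox|exact: measurableX].
rewrite [X in X * _]nul => [|j]; last exact: lohi.
rewrite [X in _ * X = _](_ : _ = leb `[(lo ord_max).1, (hi ord_max).1]%classic *
    leb `[(lo ord_max).2, (hi ord_max).2]%classic); last first.
  exact: product_measure1E.
rewrite !lebesgue_measure_itv/= !lte_fin.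
have [h1 h2] := lohi ord_max; rewrite big_ord_recr/= EFinM; congr (_ * _).
rewrite EFinM; congr (_ * _).
  by move: h1; rewrite le_eqVlt => /orP[/eqP ->|->]; rewrite ?ltxx ?subrr.
by move: h2; rewrite le_eqVlt => /orP[/eqP ->|->]; rewrite ?ltxx ?subrr.
Qed.

End snoc_measure.

(** Supplies the measure for the z' coordinates when an integral over C^(m+1) is iterated. *)
Lemma lebesgue_exists m :
  exists nu : {sigma_finite_measure set Cn R m -> \bar R}, is_lebesgue nu.
Proof.
elim: m => [|m [nu nul]].
  (* C^0 is one point and the empty product of side lengths is 1. *)
  exists (@dirac _ (Cn R 0) [tuple] R) => lo hi lohi.
  by rewrite big_ord0 /= diracE mem_set//= => -[].
pose h1 := Measure_isSigmaFinite.Build _ _ _ (snoc_measure nu)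
  (is_lebesgue_sigma_finite (is_lebesgue_snoc_measure nul)).
pose pm : {sigma_finite_measure set Cn R m.+1 -> \bar R} := HB.pack (snoc_measure nu) h1.
by exists pm; exact: is_lebesgue_snoc_measure nul.
Qed.

(** Uniqueness replaces [mu] by [snoc_measure nu], then Tonelli is applied twice. The height y is
    innermost, because the weight depends on it alone once z' is fixed. *)
Lemma integral_snocC m (mu : {measure set Cn R m.+1 -> \bar R})
    (nu : {sigma_finite_measure set Cn R m -> \bar R}) (f : Cn R m.+1 -> \bar R) :
  is_lebesgue mu -> is_lebesgue nu -> measurable_fun [set: Cn R m.+1] f -> (forall u, 0 <= f u) ->
  \int[mu]_u f u = \int[nu]_v \int[leb]_x \int[leb]_y f (snocC (v, (x, y))).
Proof.
move=> mul nul mf f0.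
rewrite (eq_measure_integral (snoc_measure nu)); last first.
  by move=> A mA _; exact: is_lebesgue_unique (is_lebesgue_snoc_measure nul) _ mA.
rewrite (@ge0_integral_pushforward _ _ _ _ _ _ (@measurable_snocC m))//.
have mfs : measurable_fun setT (f \o @snocC m).
  exact: measurableT_comp (@measurable_snocC m).
rewrite preimage_setT fubini_tonelli1//=.
apply: eq_integral => v _; rewrite /fubini_F /=.
rewrite [LHS](fubini_tonelli1 (fun q => f (snocC (v, q))))//.
exact: (measurableT_comp mfs (pair1_measurable v)).
Qed.

End lebesgue_tuple.

(** * Integrals of powers on the real line *)

Section one_dimensional_integrals.
Variable R : realType.
Local Notation leb := (@lebesgue_measure R).
Implicit Types (A B a b c p r t x : R).

Lemma continuous_powR p x : 0 < x -> {for x, continuous (@powR R ^~ p)}.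
Proof.
move=> x0; apply: differentiable_continuous; apply/derivable1_diffP.
by apply: derivable_powR; rewrite in_itv/= x0.
Qed.

Lemma within_continuous_powR p a b : 0 < a -> {within `[a, b], continuous (@powR R ^~ p)}.
Proof.
move=> a0; apply: continuous_in_subspaceT => x; rewrite inE/= in_itv/= => /andP[ax _].
by apply: continuous_powR; exact: lt_le_trans ax.
Qed.

Lemma integral_powR_segment p a b : 0 < a -> a < b -> p + 1 != 0 ->
  (\int[leb]_(x in `[a, b]) (x `^ p)%:E =
   ((b `^ (p + 1) - a `^ (p + 1)) / (p + 1))%:E)%E.
Proof.
move=> a0 ab p1.
pose F x := (p + 1)^-1 * x `^ (p + 1).
have dF x : 0 < x -> is_derive x 1 F (x `^ p).
  move=> x0; rewrite /F.
  have := @is_derive1_powR R (p + 1) x x0; rewrite addrK => d.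
  by apply: is_derive_eq; rewrite -[_ *: _]/(_ * _) mulrA mulVf ?mul1r.
have cF x : 0 < x -> {for x, continuous F}.
  move=> x0; apply: differentiable_continuous; apply/derivable1_diffP.
  by have [] := dF _ x0.
rewrite (@continuous_FTC2 _ _ F)//.
- by rewrite -EFinB /F -mulrBr mulrC.
- exact: within_continuous_powR.
- split.
  + move=> x; rewrite in_itv/= => /andP[ax _].
    by have [] := dF _ (lt_trans a0 ax).
  + by apply: cvg_at_right_filter; exact: cF.
  + by apply: cvg_at_left_filter; apply: cF; exact: lt_trans ab.
- move=> x; rewrite in_itv/= => /andP[ax _].
  by have [_] := dF _ (lt_trans a0 ax); rewrite derive1E.
Qed.

Lemma integral_inv_segment a b : 0 < a -> a < b ->
  (\int[leb]_(x in `[a, b]) (x `^ (-1))%:E = (ln b - ln a)%:E)%E.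
Proof.
move=> a0 ab.
have dF x : 0 < x -> is_derive x 1 (@ln R) (x `^ (-1)).
  by move=> x0; rewrite powR_inv1 ?ltW//; exact: is_derive1_ln.
rewrite (@continuous_FTC2 _ _ (@ln R))//.
- exact: within_continuous_powR.
- split.
  + move=> x; rewrite in_itv/= => /andP[ax _].
    by have [] := dF _ (lt_trans a0 ax).
  + by apply: cvg_at_right_filter; exact: continuous_ln.
  + by apply: cvg_at_left_filter; apply: continuous_ln; exact: lt_trans ab.
- move=> x; rewrite in_itv/= => /andP[ax _].
  by have [_] := dF _ (lt_trans a0 ax); rewrite derive1E.
Qed.

Lemma measurable_EFin_powR p (D : set R) : measurable_fun D (fun x : R => (x `^ p)%:E).
Proof.
by apply/measurable_EFinP; apply: measurable_funTS; exact: measurable_powR.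
Qed.

(** Monotone convergence reduces improper integrals to segments away from 0, where the fundamental
    theorem of calculus applies. *)
Lemma ge0_integral_bigcup_le (F : (set R)^nat) (f : R -> \bar R) (M : \bar R) :
  nondecreasing_seq F -> (forall k, measurable (F k)) ->
  (forall k, measurable_fun (F k) f) -> (forall k x, F k x -> 0 <= f x)%E ->
  (forall k, \int[leb]_(x in F k) f x <= M)%E ->
  (\int[leb]_(x in \bigcup_k F k) f x <= M)%E.
Proof.
move=> ndF mF mf f0 fM.
have cv := @ge0_nondecreasing_set_cvg_integral _ (measurableTypeR R) _ F f leb ndF mF mf f0.
by apply: (cvge_le _ cv); near=> k; exact: fM.
Unshelve. end_near. Qed.

Lemma integral_powR_near0_le p A : -1 < p -> 0 < A ->
  (\int[leb]_(x in `]0%R, A]) (x `^ p)%:E <= (A `^ (p + 1) / (p + 1))%:E)%E.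
Proof.
move=> p1 A0; have p10 : 0 < p + 1 by rewrite -ltrBlDr sub0r.
(* The divisor starts at 2 so that already the first segment is nondegenerate. *)
have -> : `]0, A]%classic = \bigcup_k `[A * k.+2%:R^-1, A]%classic.
  apply/seteqP; split => x /=; rewrite in_itv/=.
    move=> /andP[x0 xA].
    exists (Num.truncn (A / x)) => //=; rewrite in_itv/= xA andbT.
    rewrite ler_pdivrMr// mulrC -ler_pdivrMr//.
    apply: ltW; apply: (lt_trans (truncnS_gt _)).
    by rewrite ltr_nat.
  move=> [k _] /=; rewrite in_itv/= => /andP[h ->]; rewrite andbT.
  by apply: lt_le_trans h; rewrite divr_gt0.
apply: ge0_integral_bigcup_le => //.
- move=> k l kl; apply/subsetPset => x /=; rewrite !in_itv/= => /andP[h ->]; rewrite andbT.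
  by apply: le_trans h; rewrite ler_pM2l// lef_pV2 ?posrE// ler_nat !ltnS.
- by move=> k; exact: measurable_EFin_powR.
- by move=> k x _; rewrite lee_fin powR_ge0.
- move=> k; rewrite integral_powR_segment ?gt_eqF//.
  + rewrite lee_fin ler_pM2r ?invr_gt0// gerBl; exact: powR_ge0.
  + by rewrite divr_gt0.
  + by rewrite ltr_pdivrMr// ltr_pMr// ltr1n.
Qed.

Lemma integral_powR_tail_le p A : p < -1 -> 0 < A ->
  (\int[leb]_(x in `[A, +oo[) (x `^ p)%:E <= (A `^ (p + 1) / - (p + 1))%:E)%E.
Proof.
move=> p1 A0; have p10 : p + 1 < 0 by rewrite -ltrBrDr sub0r.
have -> : `[A, +oo[%classic = \bigcup_k `[A, A + k.+1%:R]%classic.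
  apply/seteqP; split => x /=; rewrite in_itv/= andbT.
    move=> Ax; exists (Num.truncn (x - A)) => //=; rewrite in_itv/= Ax/=.
    by rewrite -lerBlDl ltW// truncnS_gt.
  by move=> [k _] /=; rewrite in_itv/= => /andP[].
apply: ge0_integral_bigcup_le => //.
- move=> k l kl; apply/subsetPset => x /=; rewrite !in_itv/= => /andP[-> h] /=.
  by apply: (le_trans h); rewrite lerD2l ler_nat.
- by move=> k; exact: measurable_EFin_powR.
- by move=> k x _; rewrite lee_fin powR_ge0.
- move=> k; rewrite integral_powR_segment ?lt_eqF//; last by rewrite ltrDl.
  rewrite lee_fin invrN mulrN -mulNr ler_nM2r ?invr_lt0// lerBrDl addrC.
  by rewrite addNr powR_ge0.
Qed.

(** On ]0, 1] the integrand dominates 1/x, whose integral over [exp(-N), 1] is exactly N. *)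
Lemma integral_powR_near0_infty p : p <= -1 ->
  (\int[leb]_(x in `]0%R, 1%R]) (x `^ p)%:E = +oo)%E.
Proof.
move=> p1; apply: eq_infty => M.
pose N := Num.max M 1.
have N0 : 0 < N by rewrite lt_max ltr01 orbT.
have e0 : 0 < expR (- N) by exact: expR_gt0.
have e1 : expR (- N) < 1 by rewrite expR_lt1 oppr_lt0.
apply: (@le_trans _ _ N%:E); first by rewrite lee_fin le_max lexx.
have -> : N%:E = (\int[leb]_(x in `[expR (- N), 1%R]) (x `^ (-1))%:E)%E.
  by rewrite integral_inv_segment// ln1 expRK sub0r opprK.
apply: (@le_trans _ _ (\int[leb]_(x in `[expR (- N), 1%R]) (x `^ p)%:E)%E).
  apply: ge0_le_integral => //.
  - by move=> x _; rewrite lee_fin powR_ge0.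
  - exact: measurable_EFin_powR.
  - exact: measurable_EFin_powR.
  - move=> x /=; rewrite in_itv/= => /andP[ex x1]; rewrite lee_fin.
    by apply: ger_powR => //; rewrite x1 (lt_le_trans e0).
apply: ge0_subset_integral => //.
- exact: measurable_EFin_powR.
- by move=> x _; rewrite lee_fin powR_ge0.
- by move=> x /=; rewrite !in_itv/= => /andP[ex ->]; rewrite (lt_le_trans e0).
Qed.

(** The image of Lebesgue measure under a translation has the same values on the intervals ]a, b],
    hence is Lebesgue measure. *)
Lemma integral_shift (f : R -> \bar R) t : measurable_fun [set: R] f ->
  (forall x, 0 <= f x)%E ->
  (\int[leb]_x f (x + t)%R = \int[leb]_x f x)%E.
Proof.
move=> mf f0.
pose sh (x : measurableTypeR R) : measurableTypeR R := x + t.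
have msh : measurable_fun setT sh by exact: measurable_funD.
rewrite [LHS](_ : _ = \int[leb]_(x in sh @^-1` setT) (f \o sh) x)%E; last first.
  by rewrite preimage_setT.
rewrite -(@ge0_integral_pushforward _ _ _ _ _ sh)//.
apply: eq_measure_integral => A mA _; apply/esym.
pose pm := measure_function_pushforward__canonical__measure_function_Measure leb msh.
apply: (@lebesgue_measure_unique _ pm) => // _ [[a b]] _ <- /=.
rewrite /pushforward [X in leb X = _](_ : _ = `]a, b]%classic)//.
rewrite (_ : sh @^-1` _ = `](a - t), (b - t)]%classic).
  by rewrite !lebesgue_measure_itv/= !lte_fin ltrD2r -!EFinB opprB addrA subrK.
by apply/seteqP; split => x /=; rewrite !in_itv/= ltrBlDr lerBrDr.
Qed.

(** Centred at t the integrand is even, so the half-line is counted twice; a translation by B turns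
    it into the tail of x^(-c) from B. *)
Lemma integral_norm_powR_le B c t : 0 < B -> 1 < c ->
  (\int[leb]_x ((B + `|x - t|) `^ (- c))%:E <= (2 / (c - 1) * B `^ (1 - c))%:E)%E.
Proof.
move=> B0 c1.
pose g x := (B + `|x|) `^ (- c).
have g0 x : 0 <= g x by exact: powR_ge0.
have cg : continuous g.
  move=> x; apply: (@continuous_comp _ _ _ (fun x : R => B + `|x|) (@powR R ^~ (- c))).
    by apply: cvgD; [exact: cvg_cst|exact: norm_continuous].
  by apply: continuous_powR; rewrite ltr_wpDr.
have mg : measurable_fun setT (EFin \o g).
  by apply/measurable_EFinP; exact: continuous_measurable_fun.
rewrite (@integral_shift (EFin \o g) (- t))//.
rewrite (@ge0_symfun_integralT _ g)//; last by move=> x; rewrite /g /= normrN.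
rewrite -set_itvcy -mulrA EFinM lee_pmul2l//.
apply: (@le_trans _ _ (\int[leb]_(x in `[B, +oo[) (x `^ (- c))%:E)%E); last first.
  apply: (le_trans (integral_powR_tail_le _ B0)); first by rewrite ltrN2.
  by rewrite lee_fin opprD opprK [_ - 1 in X in _ <= X]addrC addrC (addrC 1) mulrC.
rewrite [leLHS]integral_mkcond [leRHS]integral_mkcond.
rewrite -(@integral_shift ((fun x : R => (x `^ (- c))%:E) \_ `[B, +oo[) B).
- apply: ge0_le_integral => //.
  + by move=> x _; apply: erestrict_ge0 => y _; rewrite lee_fin.
  + by apply/(measurable_restrictT _ _).1 => //; exact: measurable_funTS mg.
  + apply: (measurableT_comp _ _) => //.
      apply/(measurable_restrictT _ _).1 => //; exact: measurable_EFin_powR.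
    exact: measurable_funD.
  + move=> x _; rewrite !patchE !mem_setE !in_itv /= !andbT lerDr.
    by case: ifPn => // x0; rewrite /g ger0_norm// addrC.
- apply/(measurable_restrictT _ _).1 => //; exact: measurable_EFin_powR.
- by move=> x; apply: erestrict_ge0 => y _; rewrite lee_fin powR_ge0.
Qed.

End one_dimensional_integrals.

(** * Integrals over the single real coordinates of the kernel *)

Section kernel_integrals.
Variable R : realType.
Local Notation leb := (@lebesgue_measure R).
Implicit Types (A B a b c p r s t x y : R).

Lemma powR_le_neg p x y : p <= 0 -> 0 < x -> x <= y -> y `^ p <= x `^ p.
Proof.
move=> p0 x0 xy; rewrite -[p]opprK powRN (powRN x) lef_pV2 ?posrE ?powR_gt0//; last first.
  exact: lt_le_trans xy.
by apply: ge0_ler_powR; rewrite ?nnegrE ?oppr_ge0// ltW// (lt_le_trans x0).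
Qed.

(** For x != 0 the map t -> t^x reaches every positive value, so k t^x can be made equal to |C| + 1,
    whatever the sign of x. *)
Lemma powR_bounded_exponent0 (k C x : R) : 0 < k ->
  (forall t, 0 < t -> k * t `^ x <= C) -> x = 0.
Proof.
move=> k0 h; apply/eqP; apply/negPn/negP => x0.
have y0 : 0 < (`|C| + 1) / k by rewrite divr_gt0// ltr_wpDl.
have := h (((`|C| + 1) / k) `^ x^-1) (powR_gt0 _ y0).
rewrite -powRrM mulVf// powRr1 ?(ltW y0)// mulrCA divff ?gt_eqF// mulr1.
have := ler_norm C; lra.
Qed.

Lemma measurable_height b c B t : measurable_fun [set: R]
  (fun y : R => if t < y then (y - t) `^ b * (B + (y - t)) `^ (- c) else 0).
Proof.
have my : measurable_fun [set: R] (fun y : R => y - t) by exact: measurable_funB.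
apply: measurable_fun_ifT => //; first exact: measurable_fun_ltr.
apply: measurable_funM; first exact: (measurableT_comp (measurable_powR _) my).
by apply: (measurableT_comp (measurable_powR _)); exact: measurable_funD.
Qed.

(** With the boundary moved to 0, split at height B: below it the second factor is at most B^(-c),
    above it at most y^(-c). Both pieces have order B^(b+1-c); b > -1 serves the first and c > b + 1
    the second, and the two summands of K belong to them. *)
Lemma integral_height_le b c : -1 < b -> b + 1 < c -> exists2 K : R, 0 <= K &
  forall B t, 0 < B ->
  (\int[leb]_y (if t < y then (y - t) `^ b * (B + (y - t)) `^ (- c) else 0)%:E
    <= (K * B `^ (b + 1 - c))%:E)%E.
Proof.
move=> b1 bc; exists ((b + 1)^-1 + (c - b - 1)^-1).
  by rewrite addr_ge0// invr_ge0; lra.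
move=> B t B0.
have c0 : 0 < c by lra.
pose g y := if 0 < y then y `^ b * (B + y) `^ (- c) else 0.
have g0 y : 0 <= g y by rewrite /g; case: ifP => // _; rewrite mulr_ge0 ?powR_ge0.
have mg : measurable_fun setT g.
  by have := measurable_height b c B 0; under eq_fun do rewrite subr0.
rewrite (eq_integral (fun y : measurableTypeR R => (EFin \o g) (y - t))); last first.
  by move=> y _ /=; rewrite /g subr_gt0.
rewrite (@integral_shift _ (EFin \o g) (- t)); [|exact/measurable_EFinP|by []].
rewrite (_ : \int[leb]_x _ = \int[leb]_(x in `]0%R, B] `|` `]B, +oo[) (EFin \o g) x)%E; last first.
  rewrite (_ : _ `|` _ = `]0, +oo[%classic); last first.
    apply/seteqP; split => x /=; rewrite !in_itv/= !andbT.
      by move=> [/andP[]//|]; exact: lt_trans.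
    by move=> x0; rewrite x0/=; case: (leP x B) => h; [left|right].
  rewrite [RHS]integral_mkcond; apply: eq_integral => x _ /=.
  by rewrite patchE mem_setE in_itv/= andbT /g; case: ifP.
rewrite ge0_integral_setU//=; last 3 first.
- by apply/measurable_EFinP; exact: measurable_funTS.
- by move=> x _; rewrite lee_fin.
- apply/disj_setPRL => x /=; rewrite !in_itv/= => /andP[Bx _].
  by apply/negP; rewrite negb_and -ltNge Bx orbT.
rewrite mulrDl EFinD; apply: leeD.
- apply: (@le_trans _ _ (\int[leb]_(x in `]0%R, B]) ((B `^ (- c))%:E * (x `^ b)%:E))%E).
    apply: ge0_le_integral => //.
    + by move=> x _; rewrite lee_fin.
    + by apply/measurable_EFinP; exact: measurable_funTS.
    + by apply: measurable_funeM; exact: measurable_EFin_powR.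
    + move=> x /=; rewrite in_itv/= => /andP[x0 xB].
      rewrite -EFinM lee_fin /g x0 mulrC ler_wpM2r ?powR_ge0//.
      by apply: powR_le_neg => //; lra.
  rewrite ge0_integralZl//; last 3 first.
  + exact: measurable_EFin_powR.
  + by move=> x _; rewrite lee_fin powR_ge0.
  + by rewrite lee_fin powR_ge0.
  apply: (@le_trans _ _ ((B `^ (- c))%:E * (B `^ (b + 1) / (b + 1))%:E)%E).
    by apply: lee_wpmul2l; [rewrite lee_fin powR_ge0|exact: integral_powR_near0_le].
  rewrite -EFinM lee_fin mulrA -powRD ?(gt_eqF B0) ?implybT//.
  by rewrite mulrC (addrC (- c)).
- apply: (@le_trans _ _ (\int[leb]_(x in `[B, +oo[) (x `^ (b - c))%:E)%E); last first.
    apply: (le_trans (integral_powR_tail_le _ B0)); first by lra.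
    rewrite lee_fin mulrC.
    have -> : - (b - c + 1) = c - b - 1 by ring.
    by have -> : b - c + 1 = b + 1 - c by ring.
  apply: (@le_trans _ _ (\int[leb]_(x in `]B, +oo[) (x `^ (b - c))%:E)%E).
    apply: ge0_le_integral => //.
    + by move=> x _; rewrite lee_fin.
    + by apply/measurable_EFinP; exact: measurable_funTS.
    + exact: measurable_EFin_powR.
    + move=> x /=; rewrite in_itv/= andbT => Bx.
      have x0 : 0 < x by exact: lt_trans Bx.
      rewrite lee_fin /g x0 powRD ?(gt_eqF x0) ?implybT//.
      by rewrite ler_wpM2l ?powR_ge0//; apply: powR_le_neg => //; lra.
  apply: ge0_subset_integral => //.
  + exact: measurable_EFin_powR.
  + by move=> x _; rewrite lee_fin powR_ge0.
  + by move=> x /=; rewrite !in_itv/= !andbT; exact: ltW.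
Qed.

(** Since (q + v)^2 / 4 <= q^2 + v^2 / 2, taken with q^2 = B, this is [integral_norm_powR_le] at
    exponent 2s; the 4 becomes the factor 4^s. *)
Lemma integral_sqr_le s : 2^-1 < s -> exists2 K : R, 0 <= K &
  forall B t, 0 < B ->
  (\int[leb]_y ((B + (y - t) ^+ 2 / 2) `^ (- s))%:E <= (K * B `^ (2^-1 - s))%:E)%E.
Proof.
move=> s2; exists (4 `^ s * (2 / (2 * s - 1))).
  by rewrite mulr_ge0 ?powR_ge0// divr_ge0//; lra.
move=> B t B0.
have sB0 : 0 < Num.sqrt B by rewrite sqrtr_gt0.
have m1 : measurable_fun [set: R] (fun y : R => (Num.sqrt B + `|y - t|) `^ (- (2 * s))).
  apply: (measurableT_comp (measurable_powR _)); apply: measurable_funD => //.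
  by apply: measurableT_comp => //; exact: measurable_funB.
apply: (@le_trans _ _ (\int[leb]_y ((4 `^ s)%:E * ((Num.sqrt B + `|y - t|) `^ (- (2 * s)))%:E))%E).
  apply: ge0_le_integral => //.
  - by move=> y _; rewrite lee_fin powR_ge0.
  - apply/measurable_EFinP; apply: (measurableT_comp (measurable_powR _)).
    apply: measurable_funD => //; apply: measurable_funM => //.
    by apply: measurable_funX; exact: measurable_funB.
  - by apply: measurable_funeM; exact/measurable_EFinP.
  - move=> y _; rewrite -EFinM lee_fin.
    set v := `|y - t|; have v0 : 0 <= v by exact: normr_ge0.
    have -> : (y - t) ^+ 2 = v ^+ 2 by rewrite real_normK// num_real.
    have sv : 0 < Num.sqrt B + v by rewrite ltr_wpDr.
    have -> : 4 `^ s * (Num.sqrt B + v) `^ (- (2 * s)) = ((Num.sqrt B + v) ^+ 2 / 4) `^ (- s).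
      rewrite powRM ?sqr_ge0// -mulrN powRrM -powR_mulrn ?ltW// mulrC.
      by rewrite -(@powR_inv1 _ 4)// -(powRrM 4) mulN1r opprK.
    apply: powR_le_neg; [lra| by rewrite divr_gt0// exprn_gt0|].
    have key (q w : R) : (q + w) ^+ 2 / 4 <= q ^+ 2 + w ^+ 2 / 2.
      by have := sqr_ge0 (q - w); have := sqr_ge0 q; rewrite !expr2; nra.
    by apply: (le_trans (key _ _)); rewrite sqr_sqrtr// ltW.
rewrite ge0_integralZl//; last exact/measurable_EFinP.
rewrite -mulrA EFinM; apply: lee_wpmul2l; first by rewrite lee_fin powR_ge0.
apply: (le_trans (@integral_norm_powR_le _ _ _ _ _ _)) => //; first by lra.
rewrite lee_fin ler_wpM2l//; first by rewrite divr_ge0//; lra.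
rewrite -powR12_sqrt ?(ltW B0)// -powRrM.
by have -> : 2^-1 * (1 - 2 * s) = 2^-1 - s by lra.
Qed.

(** Each real variable lowers the exponent s by 1/2; the inner integral is estimated with the x term
    absorbed in B. *)
Lemma integral_sqr2_le s : 1 < s -> exists2 K : R, 0 <= K &
  forall B t1 t2, 0 < B ->
  (\int[leb]_x \int[leb]_y ((B + (x - t1) ^+ 2 / 2 + (y - t2) ^+ 2 / 2) `^ (- s))%:E
    <= (K * B `^ (1 - s))%:E)%E.
Proof.
move=> s1.
have [K1 K10 h1] := @integral_sqr_le s ltac:(lra).
have [K2 K20 h2] := @integral_sqr_le (s - 2^-1) ltac:(lra).
exists (K1 * K2); first exact: mulr_ge0.
move=> B t1 t2 B0.
have Bx x : 0 < B + (x - t1) ^+ 2 / 2 by rewrite ltr_wpDr// divr_ge0// sqr_ge0.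
have mB : measurable_fun setT (fun x : R => B + (x - t1) ^+ 2 / 2).
  apply: measurable_funD => //; apply: measurable_funM => //.
  by apply: measurable_funX; exact: measurable_funB.
apply: (@le_trans _ _ (\int[leb]_x (K1%:E * ((B + (x - t1) ^+ 2 / 2) `^ (- (s - 2^-1)))%:E))%E).
  apply: ge0_le_integral => //.
  - by move=> x _; apply: integral_ge0 => y _; rewrite lee_fin powR_ge0.
  - pose f (q : measurableTypeR R * measurableTypeR R) :=
      ((B + (q.1 - t1) ^+ 2 / 2 + (q.2 - t2) ^+ 2 / 2) `^ (- s))%:E.
    apply: (@measurable_fun_fubini_tonelli_F _ _ _ _ _ leb f).
      apply/measurable_EFinP; apply: (measurableT_comp (measurable_powR _)).
      apply: measurable_funD; first exact: (measurableT_comp mB measurable_fst).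
      apply: measurable_funM => //; apply: measurable_funX.
      by apply: measurable_funB => //; exact: measurable_snd.
    by move=> q; rewrite lee_fin powR_ge0.
  - by apply: measurable_funeM; apply/measurable_EFinP;
       exact: (measurableT_comp (measurable_powR _) mB).
  - move=> x _; apply: (le_trans (h1 _ _ (Bx x))).
    by rewrite -EFinM opprB.
rewrite ge0_integralZl//; last 2 first.
- by apply/measurable_EFinP; exact: (measurableT_comp (measurable_powR _) mB).
- by move=> x _; rewrite lee_fin powR_ge0.
rewrite -mulrA EFinM; apply: lee_wpmul2l; first by rewrite lee_fin.
apply: (le_trans (h2 _ _ B0)); rewrite lee_fin ler_wpM2l//.
by have -> : 2^-1 - (s - 2^-1) = 1 - s by lra.
Qed.

End kernel_integrals.

(** * The modulus against the real and imaginary parts *)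

Section modulus.
Variable R : realType.
Implicit Types w : R[i].

Lemma cabs_ge0 w : 0 <= cabs w. Proof. exact: sqrtr_ge0. Qed.

Lemma cabsM w1 w2 : cabs (w1 * w2) = cabs w1 * cabs w2.
Proof.
case: w1 w2 => [x1 y1] [x2 y2]; rewrite /cabs /= -sqrtrM ?addr_ge0 ?sqr_ge0//.
by congr Num.sqrt; ring.
Qed.

Lemma Re_le_cabs w : `|complex.Re w| <= cabs w.
Proof.
by rewrite -sqrtr_sqr ler_sqrt ?addr_ge0 ?sqr_ge0// lerDl sqr_ge0.
Qed.

Lemma Im_le_cabs w : `|complex.Im w| <= cabs w.
Proof.
by rewrite -sqrtr_sqr ler_sqrt ?addr_ge0 ?sqr_ge0// lerDr sqr_ge0.
Qed.

Lemma cabs_le w x y : `|complex.Re w| <= x -> `|complex.Im w| <= y -> cabs w <= x + y.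
Proof.
move=> hx hy; have x0 : 0 <= x by apply: le_trans hx.
have y0 : 0 <= y by apply: le_trans hy.
have xy : 0 <= x + y by exact: addr_ge0.
rewrite -[leRHS](ger0_norm xy) -sqrtr_sqr ler_sqrt ?sqr_ge0//.
rewrite -(real_normK (num_real (complex.Re w))) -(real_normK (num_real (complex.Im w))).
have := normr_ge0 (complex.Re w); have := normr_ge0 (complex.Im w).
move: `|complex.Re w| `|complex.Im w| hx hy => u v hx hy v0 u0.
rewrite !expr2; nra.
Qed.

Lemma cabs_ge_Re w : complex.Re w <= cabs w.
Proof. exact: le_trans (ler_norm _) (Re_le_cabs w). Qed.

Lemma cabs_gt0 w : 0 < complex.Re w -> 0 < cabs w.
Proof. by move=> h; apply: (lt_le_trans h); exact: cabs_ge_Re. Qed.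

(** With [cabs_ge_half] this makes |w| comparable to Re w + |Im w|, a form in which the variables of
    rho(z,u) can be integrated one at a time. *)
Lemma cabs_le_sum w : 0 <= complex.Re w ->
  cabs w <= complex.Re w + `|complex.Im w|.
Proof. by move=> w0; apply: cabs_le => //; rewrite ger0_norm. Qed.

Lemma cabs_ge_half w : (complex.Re w + `|complex.Im w|) / 2 <= cabs w.
Proof.
set x := complex.Re w; set y := complex.Im w.
have h : (x + `|y|) / 2 <= `|(x + `|y|) / 2| by exact: ler_norm.
apply: (le_trans h); rewrite -sqrtr_sqr ler_sqrt; last by rewrite addr_ge0// sqr_ge0.
rewrite -/x -/y -(real_normK (num_real y)).
move: `|y| => v; have := sqr_ge0 (x - v); rewrite !expr2; nra.
Qed.

Lemma cabs_polar (r t : R) : 0 <= r -> cabs (r%:C%C * Complex (cos t) (sin t)) = r.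
Proof.
move=> r0; rewrite /cabs /= !mul0r subr0 addr0 !exprMn -mulrDr cos2Dsin2 mulr1.
by rewrite sqrtr_sqr ger0_norm.
Qed.

End modulus.

(** * Real and imaginary parts of rho(z,u), and measurability *)

Section coordinates.
Variable R : realType.
Implicit Type n : nat.

Lemma measurable_nth_Cn n j :
  measurable_fun [set: Cn R n] (fun z : Cn R n => nth (0, 0) z j).
Proof.
have [jn|nj] := ltnP j n.
  rewrite (_ : (fun _ => _) = fun z : Cn R n => tnth z (Ordinal jn)).
    exact: measurable_tnth.
  by apply/funext => z; rewrite (tnth_nth (0, 0)).
rewrite (_ : (fun _ => _) = cst (0, 0)); first exact: measurable_cst.
by apply/funext => z; rewrite nth_default// size_tuple.
Qed.

Lemma measurable_xco n j : measurable_fun [set: Cn R n] (fun z => xco z j).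
Proof. exact: (measurableT_comp measurable_fst (@measurable_nth_Cn n j)). Qed.

Lemma measurable_yco n j : measurable_fun [set: Cn R n] (fun z => yco z j).
Proof. exact: (measurableT_comp measurable_snd (@measurable_nth_Cn n j)). Qed.

Lemma measurable_rho n : measurable_fun [set: Cn R n] (@rho R n).
Proof.
apply: measurable_funB; first exact: measurable_yco.
by apply: measurable_sum => j; apply: measurable_funX; exact: measurable_yco.
Qed.

Lemma TBE n (z : Cn R n) : TB z <-> 0 < rho z.
Proof. by rewrite /TB /= /rho subr_gt0. Qed.

Lemma measurable_TB n : measurable (@TB R n).
Proof.
rewrite (_ : @TB R n = @rho R n @^-1` `]0, +oo[%classic).
  rewrite -[X in measurable X]setTI; apply: measurable_rho => //.
by apply/seteqP; split => z /=; rewrite in_itv/= andbT => /TBE.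
Qed.

Definition dist2 n (z u : Cn R n) : R :=
  \sum_(j < n.-1) ((xco z j - xco u j) ^+ 2 + (yco z j - yco u j) ^+ 2).

(** Half the imaginary part of the sum of squares in [rho2]. It does not involve the last
    coordinates, so for fixed z and u' it acts as a translation in x_n. *)
Definition twist n (z u : Cn R n) : R :=
  \sum_(j < n.-1) (xco z j - xco u j) * (yco z j + yco u j).

Lemma Re_sum (I : Type) (r : seq I) (P : pred I) (F : I -> R[i]) :
  complex.Re (\sum_(i <- r | P i) F i) = \sum_(i <- r | P i) complex.Re (F i).
Proof. by apply: (big_morph (@complex.Re R)) => // -[? ?] [? ?]. Qed.

Lemma Im_sum (I : Type) (r : seq I) (P : pred I) (F : I -> R[i]) :
  complex.Im (\sum_(i <- r | P i) F i) = \sum_(i <- r | P i) complex.Im (F i).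
Proof. by apply: (big_morph (@complex.Im R)) => // -[? ?] [? ?]. Qed.

Lemma Re_rho2 n (z u : Cn R n) :
  complex.Re (rho2 z u) = (rho z + rho u) / 2 + dist2 z u / 4.
Proof.
rewrite /rho2.
set S := \sum_(j < n.-1) (zco z j - _) ^+ 2.
have ReS : complex.Re S = dist2 z u - 2 * \sum_(j < n.-1) yco z j ^+ 2
    - 2 * \sum_(j < n.-1) yco u j ^+ 2.
  rewrite Re_sum /dist2 !mulr_sumr -!sumrB; apply: eq_bigr => j _.
  by rewrite /zco !expr2 /=; ring.
by case: S ReS => x y /= ->; rewrite /rho; field.
Qed.

Lemma Im_rho2 n (z u : Cn R n) :
  complex.Im (rho2 z u) = (twist z u - (xco z n.-1 - xco u n.-1)) / 2.
Proof.
rewrite /rho2.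
set S := \sum_(j < n.-1) (zco z j - _) ^+ 2.
have ImS : complex.Im S = 2 * twist z u.
  rewrite Im_sum /twist mulr_sumr; apply: eq_bigr => j _.
  by rewrite /zco !expr2 /=; ring.
by case: S ImS => x y /= ->; field.
Qed.

Lemma dist2_ge0 n (z u : Cn R n) : 0 <= dist2 z u.
Proof. by apply: sumr_ge0 => j _; rewrite addr_ge0// sqr_ge0. Qed.

Lemma Re_rho2_gt0 n (z u : Cn R n) : TB z -> TB u -> 0 < complex.Re (rho2 z u).
Proof.
move=> /TBE z0 /TBE u0; rewrite Re_rho2 ltr_pwDl//; last by rewrite divr_ge0// dist2_ge0.
by rewrite divr_gt0// addr_gt0.
Qed.

Lemma measurable_dist2 n :
  measurable_fun [set: Cn R n * Cn R n] (fun p => dist2 p.1 p.2).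
Proof.
have mx1 j : measurable_fun [set: Cn R n * Cn R n] (fun p => xco p.1 j).
  exact: (measurableT_comp (@measurable_xco n j)).
have mx2 j : measurable_fun [set: Cn R n * Cn R n] (fun p => xco p.2 j).
  exact: (measurableT_comp (@measurable_xco n j)).
have my1 j : measurable_fun [set: Cn R n * Cn R n] (fun p => yco p.1 j).
  exact: (measurableT_comp (@measurable_yco n j)).
have my2 j : measurable_fun [set: Cn R n * Cn R n] (fun p => yco p.2 j).
  exact: (measurableT_comp (@measurable_yco n j)).
apply: measurable_sum => j; apply: measurable_funD;
  by apply: measurable_funX; exact: measurable_funB.
Qed.

Lemma measurable_Re_rho2 n :
  measurable_fun [set: Cn R n * Cn R n] (fun p => complex.Re (rho2 p.1 p.2)).
Proof.
under eq_fun do rewrite Re_rho2.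
apply: measurable_funD; last first.
  by apply: measurable_funM => //; exact: measurable_dist2.
apply: measurable_funM => //; apply: measurable_funD.
  exact: (measurableT_comp (@measurable_rho n)).
exact: (measurableT_comp (@measurable_rho n)).
Qed.

Lemma measurable_Im_rho2 n :
  measurable_fun [set: Cn R n * Cn R n] (fun p => complex.Im (rho2 p.1 p.2)).
Proof.
under eq_fun do rewrite Im_rho2.
have mx1 j : measurable_fun [set: Cn R n * Cn R n] (fun p => xco p.1 j).
  exact: (measurableT_comp (@measurable_xco n j)).
have mx2 j : measurable_fun [set: Cn R n * Cn R n] (fun p => xco p.2 j).
  exact: (measurableT_comp (@measurable_xco n j)).
have my1 j : measurable_fun [set: Cn R n * Cn R n] (fun p => yco p.1 j).
  exact: (measurableT_comp (@measurable_yco n j)).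
have my2 j : measurable_fun [set: Cn R n * Cn R n] (fun p => yco p.2 j).
  exact: (measurableT_comp (@measurable_yco n j)).
apply: measurable_funM => //; apply: measurable_funB; last exact: measurable_funB.
apply: measurable_sum => j; apply: measurable_funM; first exact: measurable_funB.
exact: measurable_funD.
Qed.

Lemma measurable_cabs_rho2 n :
  measurable_fun [set: Cn R n * Cn R n] (fun p => cabs (rho2 p.1 p.2)).
Proof.
rewrite /cabs; under eq_fun do rewrite -powR12_sqrt ?addr_ge0 ?sqr_ge0//.
apply: (measurableT_comp (measurable_powR _)).
apply: measurable_funD; apply: measurable_funX.
  exact: measurable_Re_rho2.
exact: measurable_Im_rho2.
Qed.

Lemma xco_snocC m (v : Cn R m) (q : R * R) (j : nat) : (j < m)%N ->
  xco (snocC (v, q)) j = xco v j.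
Proof. by move=> jm; rewrite /xco /= nth_rcons size_tuple jm. Qed.

Lemma yco_snocC m (v : Cn R m) (q : R * R) (j : nat) : (j < m)%N ->
  yco (snocC (v, q)) j = yco v j.
Proof. by move=> jm; rewrite /yco /= nth_rcons size_tuple jm. Qed.

Lemma xco_snocC_last m (v : Cn R m) (q : R * R) : xco (snocC (v, q)) m = q.1.
Proof. by rewrite /xco /= nth_rcons size_tuple ltnn eqxx. Qed.

Lemma yco_snocC_last m (v : Cn R m) (q : R * R) : yco (snocC (v, q)) m = q.2.
Proof. by rewrite /yco /= nth_rcons size_tuple ltnn eqxx. Qed.

Lemma rho_snocC m (v : Cn R m) (q : R * R) :
  rho (snocC (v, q)) = q.2 - \sum_(j < m) yco v j ^+ 2.
Proof.
rewrite /rho /= yco_snocC_last; congr (_ - _).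
by apply: eq_bigr => j _; rewrite yco_snocC.
Qed.

End coordinates.

(** * Upper estimate of the kernel integral I(z) *)

Section forelli_rudin.
Variable R : realType.
Local Notation leb := (@lebesgue_measure R).
Implicit Types (a b c B s : R) (m n : nat).

Lemma is_lebesgue_setT_neq0 n (mu : {measure set Cn R n -> \bar R}) :
  is_lebesgue mu -> mu setT != 0%E.
Proof.
move=> mul; rewrite gt_eqF//.
have := mul (fun=> (0, 0)) (fun=> (1, 1)) ltac:(by move=> j; rewrite ler01).
set A := (X in mu X = _) => muA.
have mA : measurable A by exact: measurable_cbox.
apply: (@lt_le_trans _ _ (mu A)); last by apply: le_measure; rewrite ?inE.
by rewrite muA lte_fin prodr_gt0// => j _; rewrite /= subr0 mulr1.
Qed.

Section tonelli_last.
Variables (m : nat) (f : Cn R m.+1 -> \bar R).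
Hypotheses (mf : measurable_fun [set: Cn R m.+1] f) (f0 : forall u, (0 <= f u)%E).

Let mfs : measurable_fun setT (f \o @snocC R m).
Proof. exact: measurableT_comp (@measurable_snocC R m). Qed.

Lemma measurable_integral_last (v : Cn R m) :
  measurable_fun [set: R] (fun x => \int[leb]_y f (snocC (v, (x, y))))%E.
Proof.
apply: (@measurable_fun_fubini_tonelli_F _ _ _ _ _ leb (fun q => f (snocC (v, q)))) => //.
exact: (measurableT_comp mfs (pair1_measurable v)).
Qed.

Lemma integral_snocC_le (mu : {measure set Cn R m.+1 -> \bar R})
    (nu : {sigma_finite_measure set Cn R m -> \bar R}) (g : Cn R m -> \bar R) :
  is_lebesgue mu -> is_lebesgue nu -> measurable_fun [set: Cn R m] g ->
  (forall v, \int[leb]_x \int[leb]_y f (snocC (v, (x, y))) <= g v)%E ->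
  (\int[mu]_u f u <= \int[nu]_v g v)%E.
Proof.
move=> mul nul mg fg; rewrite (integral_snocC mul nul)//; apply: ge0_le_integral => //.
- by move=> v _; do 2 (apply: integral_ge0 => ? _).
- rewrite (_ : (fun v => _) = (fun v => \int[sfprod leb leb]_q f (snocC (v, q)))%E).
    apply: (@measurable_fun_fubini_tonelli_F _ _ _ _ _ (sfprod leb leb)
      (f \o @snocC R m)) => // q; exact: f0.
  apply/funext => v; apply/esym.
  apply: (fubini_tonelli1 (fun q => f (snocC (v, q)))) => //.
  exact: (measurableT_comp mfs (pair1_measurable v)).
Qed.

End tonelli_last.

(** Induction on the dimension: integrating the last complex coordinate by [integral_sqr2_le] lowers
    the exponent by 1 and leaves the same kind of integral over C^m. The centre is given by
    sequences [x], [y], so that one centre serves in every dimension. *)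
Lemma integral_Cn_le m s : m%:R < s -> exists2 K : R, 0 <= K &
  forall (nu : {sigma_finite_measure set Cn R m -> \bar R}) (x y : nat -> R) B,
  is_lebesgue nu -> 0 < B ->
  (\int[nu]_v ((B + (\sum_(j < m) ((x j - xco v j) ^+ 2 + (y j - yco v j) ^+ 2)) / 2) `^ (- s))%:E
    <= (K * B `^ (m%:R - s))%:E)%E.
Proof.
elim: m s => [|m IHm] s ms.
  exists 1 => // nu x y B nul B0.
  under eq_integral do rewrite big_ord0 mul0r addr0.
  rewrite integral_cst// mul1r sub0r.
  (* In C^0 every box is the whole space, of measure the empty product. *)
  have : nu setT = 1%E.
    have := nul (fun=> (0, 0)) (fun=> (0, 0)) (fun j => conj (lexx _) (lexx _)).
    rewrite big_ord0 => <-; congr (nu _); apply/seteqP; split => // v _ [].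
    by [].
  by move=> nu1; rewrite [X in (_ * X)%E]nu1 mule1.
have sm : m%:R < s - 1 by rewrite ltrBrDr -natr1 in ms *.
have s1 : 1 < s by have : (0 <= m%:R :> R) by []; lra.
have [K2 K20 h2] := IHm _ sm.
have [K1 K10 h1] := integral_sqr2_le s1.
exists (K1 * K2); first exact: mulr_ge0.
move=> nu x y B nul B0.
have [nu' nul'] := lebesgue_exists R m.
pose D (v : Cn R m) := B + (\sum_(j < m) ((x j - xco v j) ^+ 2 + (y j - yco v j) ^+ 2)) / 2.
have D0 v : 0 < D v.
  rewrite /D ltr_wpDr// divr_ge0// sumr_ge0// => j _.
  by rewrite addr_ge0// sqr_ge0.
have mD k : measurable_fun [set: Cn R k] (fun v : Cn R k =>
    B + (\sum_(j < k) ((x j - xco v j) ^+ 2 + (y j - yco v j) ^+ 2)) / 2).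
  apply: measurable_funD => //; apply: measurable_funM => //.
  apply: measurable_sum => j; apply: measurable_funD; apply: measurable_funX;
    apply: measurable_funB => //; [exact: measurable_xco|exact: measurable_yco].
have E v (q : R * R) : B + (\sum_(j < m.+1) ((x j - xco (snocC (v, q)) j) ^+ 2 +
    (y j - yco (snocC (v, q)) j) ^+ 2)) / 2 =
    D v + (q.1 - x m) ^+ 2 / 2 + (q.2 - y m) ^+ 2 / 2.
  rewrite big_ord_recr /= xco_snocC_last yco_snocC_last.
  under eq_bigr => j _ do rewrite xco_snocC// yco_snocC//.
  by rewrite /D; field.
apply: (@le_trans _ _ (\int[nu']_v (K1%:E * (D v `^ (- (s - 1)))%:E))%E).
  apply: (integral_snocC_le _ _ nul nul').
  - by apply/measurable_EFinP; exact: (measurableT_comp (measurable_powR _) (mD m.+1)).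
  - by move=> u; rewrite lee_fin powR_ge0.
  - by apply: measurable_funeM; apply/measurable_EFinP;
       exact: (measurableT_comp (measurable_powR _) (mD m)).
  - move=> v; apply: (le_trans _); last first.
      by have := h1 _ (x m) (y m) (D0 v); rewrite -opprB EFinM; apply.
    by under eq_integral => a _ do under eq_integral => b _ do rewrite E.
rewrite ge0_integralZl//; last 2 first.
- by apply/measurable_EFinP; exact: (measurableT_comp (measurable_powR _) (mD m)).
- by move=> v _; rewrite lee_fin powR_ge0.
rewrite -mulrA EFinM; apply: lee_wpmul2l; first by rewrite lee_fin.
apply: (le_trans (h2 nu' x y B nul' B0)).
by have -> : m%:R - (s - 1) = m.+1%:R - s by rewrite -natr1; ring.
Qed.

(** The integrand of I(z): one variable's share of the common modulus of both kernels, without the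
    weight rho(z)^a. *)
Definition ker1 n b c (z u : Cn R n) : R := rho u `^ b / cabs (rho2 z u) `^ c.

Lemma ker1_ge0 n b c (z u : Cn R n) : 0 <= ker1 b c z u.
Proof. by rewrite divr_ge0// powR_ge0. Qed.

Lemma measurable_ker1_pair n b c :
  measurable_fun [set: Cn R n * Cn R n] (fun p => ker1 b c p.1 p.2).
Proof.
rewrite /ker1; under eq_fun do rewrite -powRN.
apply: measurable_funM.
  apply: (measurableT_comp (measurable_powR _)).
  exact: (measurableT_comp (@measurable_rho R n)).
exact: (measurableT_comp (measurable_powR _) (@measurable_cabs_rho2 R n)).
Qed.

Lemma measurable_ker1 n b c (z : Cn R n) :
  measurable_fun [set: Cn R n] (ker1 b c z).
Proof. exact: (measurableT_comp (@measurable_ker1_pair n b c) (pair1_measurable z)). Qed.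

Lemma twist_snocC m (z : Cn R m.+1) (v : Cn R m) (q : R * R) :
  twist z (snocC (v, q)) = \sum_(j < m) (xco z j - xco v j) * (yco z j + yco v j).
Proof. by apply: eq_bigr => j _; rewrite xco_snocC// yco_snocC. Qed.

Lemma dist2_snocC m (z : Cn R m.+1) (v : Cn R m) (q : R * R) :
  dist2 z (snocC (v, q)) =
  \sum_(j < m) ((xco z j - xco v j) ^+ 2 + (yco z j - yco v j) ^+ 2).
Proof. by apply: eq_bigr => j _; rewrite xco_snocC// yco_snocC. Qed.

(** The parenthesis is twice Re + |Im| of rho(z,u), and the modulus is at least half of Re + |Im|;
    this accounts for 4^c. *)
Lemma ker1_le n b c (z u : Cn R n) : 0 <= c -> TB z -> TB u ->
  ker1 b c z u <= 4 `^ c * (rho u `^ b *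
    (rho z + dist2 z u / 2 + `|xco u n.-1 - (xco z n.-1 - twist z u)| + rho u) `^ (- c)).
Proof.
move=> c0 zB uB; rewrite /ker1 mulrCA ler_wpM2l ?powR_ge0//.
have z0 := (TBE z).1 zB; have u0 := (TBE u).1 uB.
have d0 := dist2_ge0 z u.
set t := `| _ |; have t0 : 0 <= t by exact: normr_ge0.
set w := rho z + _ + _ + _.
have w0 : 0 < w by rewrite /w; lra.
have -> : 4 `^ c * w `^ (- c) = (w / 4) `^ (- c).
  by rewrite powRM ?ltW// -(@powR_inv1 _ 4)// -(powRrM 4) mulN1r opprK mulrC.
rewrite -powRN; apply: powR_le_neg; [lra|by rewrite divr_gt0|].
apply: le_trans (cabs_ge_half _).
have -> : `|complex.Im (rho2 z u)| = t / 2.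
  rewrite Im_rho2 normrM [X in _ * X]ger0_norm// -/t; congr (_ / _).
  by rewrite /t; congr `| _ |; ring.
by rewrite Re_rho2 /w; lra.
Qed.

(** Bookkeeping of the exponent: the height leaves c - b - 1, then x_n leaves c - b - 2 = m + a,
    then the m coordinates of u' leave a. The last step needs m < m + a. *)
Lemma integral_ker1_le m (mu : {measure set Cn R m.+1 -> \bar R}) a b c :
  is_lebesgue mu -> 0 < a -> -1 < b -> c = m.+1%:R + 1 + a + b ->
  exists2 K : R, 0 <= K & forall z : Cn R m.+1, TB z ->
  (\int[mu]_(u in TB (n := m.+1)) (ker1 b c z u)%:E <= (K * rho z `^ (- a))%:E)%E.
Proof.
move=> mul a0 b1 cE.
have m0 : 0 <= m%:R :> R by [].
have cE' : c = m%:R + 2 + a + b by rewrite cE -natr1; ring.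
have [K1 K10 h1] := @integral_height_le R b c b1 ltac:(lra).
pose K2 := 2 / (c - b - 1 - 1).
have K20 : 0 <= K2 by rewrite divr_ge0//; lra.
have [K3 K30 h3] := @integral_Cn_le m (m%:R + a) ltac:(lra).
exists (4 `^ c * (K1 * (K2 * K3))).
  by rewrite mulr_ge0 ?powR_ge0// mulr_ge0// mulr_ge0.
move=> z zB; have z0 := (TBE z).1 zB.
have [nu nul] := lebesgue_exists R m.
pose S (v : Cn R m) := \sum_(j < m) (xco z j - xco v j) * (yco z j + yco v j).
pose D (v : Cn R m) := rho z +
  (\sum_(j < m) ((xco z j - xco v j) ^+ 2 + (yco z j - yco v j) ^+ 2)) / 2.
have D0 v : 0 < D v.
  rewrite /D ltr_wpDr// divr_ge0// sumr_ge0// => j _.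
  by rewrite addr_ge0// sqr_ge0.
have mD : measurable_fun [set: Cn R m] D.
  apply: measurable_funD => //; apply: measurable_funM => //.
  apply: measurable_sum => j; apply: measurable_funD; apply: measurable_funX;
    apply: measurable_funB => //; [exact: measurable_xco|exact: measurable_yco].
pose f := (EFin \o ker1 b c z) \_ (TB (n := m.+1)).
have mf : measurable_fun [set: Cn R m.+1] f.
  apply/(measurable_restrictT _ _).1; first exact: measurable_TB.
  by apply: measurable_funTS; apply/measurable_EFinP; exact: measurable_ker1.
have f0 u : (0 <= f u)%E by apply: erestrict_ge0 => x _; rewrite lee_fin ker1_ge0.
rewrite integral_mkcond -/f.
have -> : rho z `^ (- a) = rho z `^ (m%:R - (m%:R + a)) by congr (_ `^ _); ring.
pose k := 4 `^ c * (K1 * K2).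
have k0 : 0 <= k by rewrite /k mulr_ge0 ?powR_ge0// mulr_ge0.
apply: (@le_trans _ _ (\int[nu]_v (k%:E * (D v `^ (- (m%:R + a)))%:E))%E); last first.
  rewrite ge0_integralZl//; last 2 first.
  - by apply/measurable_EFinP; exact: (measurableT_comp (measurable_powR _) mD).
  - by move=> v _; rewrite lee_fin powR_ge0.
  rewrite (_ : _ * _ * _ = k * (K3 * rho z `^ (m%:R - (m%:R + a)))); last by rewrite /k; ring.
  rewrite [leRHS]EFinM; apply: lee_wpmul2l; first by rewrite lee_fin.
  exact: (h3 nu (xco z) (yco z) _ nul z0).
apply: (integral_snocC_le mf f0 mul nul).
  by apply: measurable_funeM; apply/measurable_EFinP;
       exact: (measurableT_comp (measurable_powR _) mD).
(* In the fibre over [v] the domain starts at height [t], and Im rho(z,u) vanishes at x = [x0]. *)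
move=> v; pose t := \sum_(j < m) yco v j ^+ 2; pose x0 := xco z m - S v.
have fle x y : (f (snocC (v, (x, y))) <= (4 `^ c)%:E *
   (if t < y then (y - t) `^ b * (D v + `|x - x0| + (y - t)) `^ (- c) else 0)%:E)%E.
  rewrite /f patchE; case: ifPn => [|_]; last first.
    rewrite mule_ge0// ?lee_fin ?powR_ge0//.
    by case: ifP => // _; rewrite mulr_ge0 ?powR_ge0.
  rewrite inE => /[dup] uB /TBE; rewrite rho_snocC /= -/t subr_gt0 => ty.
  rewrite ty -EFinM lee_fin; apply: (le_trans (ker1_le _ _ zB uB)); first lra.
  by rewrite rho_snocC dist2_snocC twist_snocC xco_snocC_last /= -/t -/(S v).
have Bx x : 0 < D v + `|x - x0| by rewrite ltr_wpDr.
have mBx : measurable_fun [set: R] (fun x : R => D v + `|x - x0|).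
  by apply: measurable_funD => //; apply: measurableT_comp => //; exact: measurable_funB.
apply: (@le_trans _ _ (\int[leb]_x ((4 `^ c * K1)%:E *
    ((D v + `|x - x0|) `^ (- (c - b - 1)))%:E))%E).
  apply: ge0_le_integral => //.
  - by move=> x _; apply: integral_ge0.
  - exact: measurable_integral_last.
  - by apply: measurable_funeM; apply/measurable_EFinP;
       exact: (measurableT_comp (measurable_powR _) mBx).
  - move=> x _.
    apply: (@le_trans _ _ (\int[leb]_y ((4 `^ c)%:E *
     (if t < y then (y - t) `^ b * (D v + `|x - x0| + (y - t)) `^ (- c) else 0)%:E))%E).
      apply: ge0_le_integral => //.
      + have := measurableT_comp mf (measurable_snocC (m := m)).
        move=> /measurableT_comp /(_ (pair1_measurable v)).
        by move=> /measurableT_comp /(_ (pair1_measurable x)).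
      + by apply: measurable_funeM; apply/measurable_EFinP; exact: measurable_height.
    rewrite ge0_integralZl//; last 2 first.
    + by apply/measurable_EFinP; exact: measurable_height.
    + by move=> y _; rewrite lee_fin; case: ifP => // _; rewrite mulr_ge0 ?powR_ge0.
    rewrite EFinM -muleA; apply: lee_wpmul2l; first by rewrite lee_fin powR_ge0.
    apply: (le_trans (h1 _ t (Bx x))); rewrite -EFinM.
    by have -> : b + 1 - c = - (c - b - 1) by ring.
rewrite ge0_integralZl//; last 3 first.
- by apply/measurable_EFinP; exact: (measurableT_comp (measurable_powR _) mBx).
- by move=> x _; rewrite lee_fin powR_ge0.
- by rewrite lee_fin mulr_ge0 ?powR_ge0.
have -> : k%:E = ((4 `^ c * K1)%:E * K2%:E)%E by rewrite -EFinM -mulrA.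
rewrite -muleA; apply: lee_wpmul2l.
  by rewrite lee_fin mulr_ge0 ?powR_ge0.
apply: (le_trans (@integral_norm_powR_le _ _ (c - b - 1) x0 (D0 v) _)); first lra.
by rewrite -EFinM /K2; have -> : 1 - (c - b - 1) = - (m%:R + a) by lra.
Qed.

End forelli_rudin.

(** * Divergence at the boundary when b <= -1 *)

Section divergence.
Variable R : realType.
Local Notation leb := (@lebesgue_measure R).
Implicit Types (a b c p t x y w : R) (m n : nat).

(** The power is monotone, in a direction given by the sign of p; the minimum covers both cases, as
    the exponents are arbitrary in the lower bounds. *)
Lemma powR_ge_min p x y w : 0 < x -> x <= w -> w <= y ->
  Num.min (x `^ p) (y `^ p) <= w `^ p.
Proof.
move=> x0 xw wy; have w0 := lt_le_trans x0 xw.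
have y0 := lt_le_trans w0 wy.
have [p0|p0] := leP 0 p.
  by rewrite ge_min ge0_ler_powR// nnegrE ltW.
by rewrite ge_min [X in _ || X]powR_le_neg ?orbT// ltW.
Qed.

Lemma leb_setT_gt0 : (0 < leb setT)%E.
Proof.
apply: (@lt_le_trans _ _ (leb `[0%R, 1%R]%classic)).
  by rewrite lebesgue_measure_itv/= lte_fin ltr01 -EFinB lte_fin subr0.
by apply: le_measure; rewrite ?inE.
Qed.

(** For heights y - t in ]0, 1] the modulus of rho(z,u) stays between two positive constants, so the
    integrand is at least k (y - t)^b, which is not integrable at 0. *)
Lemma integral_ker1_height_infty m b c (z : Cn R m.+1) (v : Cn R m) x :
  b <= -1 -> TB z ->
  (\int[leb]_y ((EFin \o ker1 b c z) \_ (@TB R m.+1)) (snocC (v, (x, y))) = +oo)%E.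
Proof.
move=> b1 zB; have z0 := (TBE z).1 zB.
set f := (EFin \o _) \_ _.
have mf : measurable_fun [set: Cn R m.+1] f.
  apply/(measurable_restrictT _ _).1; first exact: measurable_TB.
  by apply: measurable_funTS; apply/measurable_EFinP; exact: measurable_ker1.
have f0 u : (0 <= f u)%E by apply: erestrict_ge0 => q _; rewrite lee_fin ker1_ge0.
pose t := \sum_(j < m) yco v j ^+ 2.
(* [A] is the real part of rho(z,u) continued to the boundary point of the fibre, [S] the imaginary
   part, which does not depend on y. *)
pose A := rho z / 2 + (\sum_(j < m) ((xco z j - xco v j) ^+ 2 + (yco z j - yco v j) ^+ 2)) / 4.
pose S := (\sum_(j < m) (xco z j - xco v j) * (yco z j + yco v j) - (xco z m - x)) / 2.
have A0 : 0 < A.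
  rewrite /A ltr_pwDl// ?divr_gt0// divr_ge0// sumr_ge0// => j _.
  by rewrite addr_ge0// sqr_ge0.
pose k : R := Num.min (A `^ (- c)) ((A + 1 + `|S|) `^ (- c)).
have A1 : 0 < A + 1 + `|S| by have := normr_ge0 S; lra.
have k0 : 0 < k by rewrite lt_min !powR_gt0.
pose h : R -> \bar R := (fun r : R => (r `^ b)%:E) \_ `]0, 1]%classic.
have mh : measurable_fun [set: R] h.
  by apply/(measurable_restrictT _ _).1 => //; exact: measurable_EFin_powR.
have h0 r : (0 <= h r)%E by apply: erestrict_ge0 => q _; rewrite lee_fin powR_ge0.
apply/eqP; rewrite -leye_eq.
apply: (@le_trans _ _ (\int[leb]_y (k%:E * h (y - t)%R))%E).
  rewrite ge0_integralZl//; last 2 first.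
  - by apply: (measurableT_comp mh); exact: measurable_funB.
  - by rewrite lee_fin ltW.
  rewrite (@integral_shift _ h (- t))// -integral_mkcond integral_powR_near0_infty//.
  by rewrite gt0_muley// lte_fin.
apply: ge0_le_integral => //.
- by move=> y _; rewrite mule_ge0// lee_fin ltW.
- by apply: measurable_funeM; apply: (measurableT_comp mh); exact: measurable_funB.
- have := measurableT_comp mf (measurable_snocC (m := m)).
  move=> /measurableT_comp /(_ (pair1_measurable v)).
  by move=> /measurableT_comp /(_ (pair1_measurable (x : measurableTypeR R))).
- move=> y _; rewrite /h patchE; case: ifPn => [|_]; last by rewrite mule0.
  rewrite inE/= in_itv/= => /andP[ty yt1].
  have uB : TB (snocC (v, (x, y))) by apply/TBE; rewrite rho_snocC.
  rewrite /f patchE mem_set// -EFinM lee_fin /= /ker1 rho_snocC /= mulrC.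
  rewrite ler_wpM2l ?powR_ge0// -powRN.
  have ReE : complex.Re (rho2 z (snocC (v, (x, y)))) = A + (y - t) / 2.
    by rewrite Re_rho2 dist2_snocC rho_snocC /A /t /=; field.
  have ImE : complex.Im (rho2 z (snocC (v, (x, y)))) = S.
    by rewrite Im_rho2 twist_snocC xco_snocC_last.
  apply: powR_ge_min => //.
    by apply: le_trans (cabs_ge_Re _); rewrite ReE; lra.
  apply: le_trans (cabs_le_sum _) _; rewrite ReE ?ImE; first by lra.
  by rewrite lerD2r; lra.
Qed.

Lemma integral_ker1_infty m (mu : {measure set Cn R m.+1 -> \bar R}) b c (z : Cn R m.+1) :
  is_lebesgue mu -> b <= -1 -> TB z ->
  (\int[mu]_(u in @TB R m.+1) (ker1 b c z u)%:E = +oo)%E.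
Proof.
move=> mul b1 zB; rewrite integral_mkcond.
have [nu nul] := lebesgue_exists R m.
rewrite (integral_snocC mul nul); last 2 first.
- apply/(measurable_restrictT _ _).1; first exact: measurable_TB.
  by apply: measurable_funTS; apply/measurable_EFinP; exact: measurable_ker1.
- by move=> u; apply: erestrict_ge0 => q _; rewrite lee_fin ker1_ge0.
under eq_integral => v _ do under eq_integral => x _ do
  rewrite integral_ker1_height_infty//.
under eq_integral => v _ do rewrite integral_cst// gt0_mulye ?leb_setT_gt0//.
rewrite integral_cst// gt0_mulye// lt0e measure_ge0 andbT.
exact: is_lebesgue_setT_neq0.
Qed.

End divergence.

(** * Anisotropic boxes and lower bounds for the kernel *)

Section boxes.
Variable R : realType.
Implicit Types (a b c e p s t x y w : R) (m : nat).

(* Sides of order sqrt t in z' and t in z_n: on such a box rho has order t, and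
   rho2 has order t and small argument. *)
Definition tbox m e t : set (Cn R m.+1) :=
  cbox (fun j : 'I_m.+1 => if (j < m)%N then (- (e * Num.sqrt t), - (e * Num.sqrt t))
                           else (- (e * t), t))
       (fun j : 'I_m.+1 => if (j < m)%N then (e * Num.sqrt t, e * Num.sqrt t)
                           else (e * t, 2 * t)).
Arguments tbox : clear implicits.

Lemma measurable_tbox m e t : measurable (tbox m e t).
Proof. exact: measurable_cbox. Qed.

Lemma tboxP m e t (z : Cn R m.+1) : tbox m e t z ->
  (forall j, (j < m)%N -> `|xco z j| <= e * Num.sqrt t /\ `|yco z j| <= e * Num.sqrt t)
  /\ `|xco z m| <= e * t /\ t <= yco z m <= 2 * t.
Proof.
move=> zb; split=> [j jm|].
  have jm1 : (j < m.+1)%N by exact: ltnW.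
  have := zb (Ordinal jm1); rewrite /= jm (tnth_nth (0, 0)) /= => -[h1 h2].
  by rewrite !ler_norml.
by have := zb ord_max; rewrite /= ltnn (tnth_nth (0, 0)) /= => -[h1 h2]; rewrite ler_norml.
Qed.

(** Each of the m coordinates of z' contributes an area (2 e sqrt t)^2 = 4 e^2 t, and z_n
    contributes 2 e t * t: in all the power m + 2 = n + 1 of t. *)
Lemma lebesgue_tbox m (mu : {measure set Cn R m.+1 -> \bar R}) e t :
  is_lebesgue mu -> 0 < e -> 0 < t ->
  mu (tbox m e t) = ((4 * e ^+ 2) ^+ m * (2 * e) * t `^ (m.+1%:R + 1))%:E.
Proof.
move=> mul e0 t0; have st0 : 0 <= Num.sqrt t by exact: sqrtr_ge0.
have es : 0 <= e * Num.sqrt t by rewrite mulr_ge0// ltW.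
have et : 0 < e * t by rewrite mulr_gt0.
rewrite [LHS]mul; last first.
  move=> j; case: ifPn => _ /=; split; lra.
congr EFin; rewrite big_ord_recr/= ltnn/=.
rewrite (eq_bigr (fun=> 4 * e ^+ 2 * t)); last first.
  move=> j _; rewrite ltn_ord/= -[t in RHS](sqr_sqrtr (ltW t0)); ring.
rewrite prodr_const card_ord exprMn natr1 powR_mulrn ?ltW// !exprS; ring.
Qed.

Lemma powR_scale_min p x y t w : 0 < x -> 0 < y -> 0 < t -> x * t <= w -> w <= y * t ->
  Num.min (x `^ p) (y `^ p) * t `^ p <= w `^ p.
Proof.
move=> x0 y0 t0 xw wy.
have := powR_ge_min p (mulr_gt0 x0 t0) xw wy.
by rewrite !powRM ?(ltW x0) ?(ltW y0) ?(ltW t0)// -minr_pMl ?powR_ge0.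
Qed.

Lemma tbox_rho m e t (u : Cn R m.+1) : 0 < e -> m.+1%:R * e <= 12^-1 -> 0 < t ->
  tbox m e t u -> 2^-1 * t <= rho u <= 2 * t.
Proof.
move=> e0 em t0 /tboxP[h1 [_ /andP[h3 h4]]].
have st : Num.sqrt t ^+ 2 = t by rewrite sqr_sqrtr ?ltW.
have S0 : 0 <= \sum_(j < m) yco u j ^+ 2 by rewrite sumr_ge0// => j _; exact: sqr_ge0.
have S1 : \sum_(j < m) yco u j ^+ 2 <= 2^-1 * t.
  apply: (@le_trans _ _ (\sum_(j < m) (e ^+ 2 * t))).
    apply: ler_sum => j _; have [_ h] := h1 j (ltn_ord j).
    rewrite -(real_normK (num_real (yco u j))) -[t in leRHS]st -exprMn.
    by rewrite ler_pXn2r ?nnegrE// mulr_ge0 ?sqrtr_ge0// ltW.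
  rewrite sumr_const card_ord -[_ *+ m]mulr_natl mulrA ler_pM2r// expr2 mulrA.
  have m0 : 0 <= m%:R :> R by [].
  rewrite -natr1 in em; nra.
rewrite /rho /=; apply/andP; split; lra.
Qed.

Lemma tbox_TB m e t (u : Cn R m.+1) : 0 < e -> m.+1%:R * e <= 12^-1 -> 0 < t ->
  tbox m e t u -> TB u.
Proof.
move=> e0 em t0 ub; apply/TBE.
by have /andP[h _] := tbox_rho e0 em t0 ub; apply: lt_le_trans h; rewrite mulr_gt0.
Qed.

(** The larger size t dominates: Re lies between t/4 and 3t and |Im| is at most 2 e t, whence the
    ratio 8 e. Two sizes are allowed because the divergence argument keeps z in the box of size 1
    while u runs through larger ones. *)
Lemma tbox_rho2 m e s t (z u : Cn R m.+1) :
  0 < e -> m.+1%:R * e <= 12^-1 -> 0 < s -> s <= t ->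
  tbox m e s z -> tbox m e t u ->
  [/\ 4^-1 * t <= complex.Re (rho2 z u),
      cabs (rho2 z u) <= 4 * t &
      `|complex.Im (rho2 z u) / complex.Re (rho2 z u)| <= 8 * e].
Proof.
move=> e0 em s0 st zb ub; have t0 := lt_le_trans s0 st.
have m0 : 0 <= m%:R :> R by [].
have me0 : 0 <= m%:R * e by rewrite mulr_ge0// ltW.
have em' : m%:R * e + e <= 12^-1 by rewrite -{2}[e]mul1r -mulrDl natr1.
have /andP[z1 z2] := tbox_rho e0 em s0 zb.
have /andP[u1 u2] := tbox_rho e0 em t0 ub.
have [hz1 [hz2 _]] := tboxP zb; have [hu1 [hu2 _]] := tboxP ub.
pose q := e * Num.sqrt t.
have q0 : 0 <= q by rewrite mulr_ge0 ?sqrtr_ge0// ltW.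
have qq : q * q = e * e * t by rewrite -[t in RHS](sqr_sqrtr (ltW t0)) /q; ring.
have sq : e * Num.sqrt s <= q by rewrite ler_wpM2l ?(ltW e0)// ler_wsqrtr.
(* The contributions of z' are of order m e^2 t; the bound on (m + 1) e makes them small multiples
   of e t, uniformly in the dimension. *)
have met : m%:R * (q * q) <= 12^-1 * (e * t).
  have : m%:R * e * (e * t) <= 12^-1 * (e * t).
    by rewrite ler_wpM2r// ?mulr_ge0 ?ltW//; lra.
  by rewrite qq; congr (_ <= _); ring.
have d0 := dist2_ge0 z u.
have et0 : 0 < e * t by rewrite mulr_gt0.
have et1 : e * t <= 12^-1 * t by rewrite ler_wpM2r ?(ltW t0)//; lra.
have bz j : (j < m)%N -> `|xco z j| <= q /\ `|yco z j| <= q.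
  by move=> /hz1[? ?]; split; apply: le_trans sq.
have d1 : dist2 z u <= 8 * (m%:R * (q * q)).
  apply: (@le_trans _ _ (\sum_(j < m) (8 * (q * q)))); last first.
    by rewrite sumr_const card_ord -[_ *+ m]mulr_natl mulrCA.
  apply: ler_sum => j _; have [zx zy] := bz j (ltn_ord j).
  have [ux uy] := hu1 j (ltn_ord j); move: zx zy ux uy; rewrite -/q !ler_norml !expr2.
  move: (xco z j) (yco z j) (xco u j) (yco u j) => X1 Y1 X2 Y2.
  move=> /andP[? ?] /andP[? ?] /andP[? ?] /andP[? ?]; nra.
have tw : `|twist z u| <= 4 * (m%:R * (q * q)).
  apply: (@le_trans _ _ (\sum_(j < m) (4 * (q * q)))); last first.
    by rewrite sumr_const card_ord -[_ *+ m]mulr_natl mulrCA.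
  apply: (le_trans (ler_norm_sum _ _ _)); apply: ler_sum => j _.
  have [zx zy] := bz j (ltn_ord j); have [ux uy] := hu1 j (ltn_ord j).
  have -> : 4 * (q * q) = (2 * q) * (2 * q) by ring.
  rewrite normrM ler_pM//.
    by apply: (le_trans (ler_normB _ _)); rewrite -/q in ux; lra.
  by apply: (le_trans (ler_normD _ _)); rewrite -/q in uy; lra.
have es : e * s <= e * t by rewrite ler_pM2l.
have Re1 : 4^-1 * t <= complex.Re (rho2 z u) by rewrite Re_rho2; lra.
have Re2 : complex.Re (rho2 z u) <= 3 * t by rewrite Re_rho2; lra.
have Im1 : `|complex.Im (rho2 z u)| <= 2 * (e * t).
  rewrite Im_rho2 normrM [X in _ * X]ger0_norm//.
  have hb := ler_normB (twist z u) (xco z m - xco u m).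
  have hc := ler_normB (xco z m) (xco u m).
  rewrite /=; lra.
have Re0 : 0 < complex.Re (rho2 z u) by apply: lt_le_trans Re1; rewrite mulr_gt0.
split => //.
  apply: (le_trans (cabs_le_sum (ltW Re0))); lra.
rewrite normrM normfV (ger0_norm (ltW Re0)) ler_pdivrMr//.
apply: (le_trans Im1); rewrite [leRHS]mulrAC -mulrA mulrCA.
have := ler_wpM2l (ltW e0) Re1; lra.
Qed.

(** Both rho(u) and |rho(z,u)| are comparable to t here; the minima are there because b and c have
    no known sign. *)
Lemma ker1_tbox_ge m b c e : 0 < e -> m.+1%:R * e <= 12^-1 ->
  exists2 K : R, 0 < K & forall s t z, 0 < s -> s <= t -> tbox m e s z ->
  (forall u, tbox m e t u -> K * t `^ (b - c) <= ker1 b c z u).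
Proof.
move=> e0 em.
exists (Num.min (2^-1 `^ b) (2 `^ b) * Num.min (4^-1 `^ (- c)) (4 `^ (- c))).
  by rewrite mulr_gt0// lt_min !powR_gt0.
move=> s t z s0 st zb u ub; have t0 := lt_le_trans s0 st.
have /andP[u1 u2] := tbox_rho e0 em t0 ub.
have [r1 r2 _] := tbox_rho2 e0 em s0 st zb ub.
rewrite /ker1 -powRN powRD ?(gt_eqF t0) ?implybT// mulrACA ler_pM//.
- by rewrite mulr_ge0 ?powR_ge0// le_min !powR_ge0.
- by rewrite mulr_ge0 ?powR_ge0// le_min !powR_ge0.
- exact: powR_scale_min.
- apply: powR_scale_min => //; exact: le_trans (cabs_ge_Re _).
Qed.

Lemma integral_ker1_tbox_ge m (mu : {measure set Cn R m.+1 -> \bar R}) b c e :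
  is_lebesgue mu -> 0 < e -> m.+1%:R * e <= 12^-1 ->
  exists2 K : R, 0 < K & forall s t z, 0 < s -> s <= t -> tbox m e s z ->
  ((K * t `^ (b - c + (m.+1%:R + 1)))%:E <=
    \int[mu]_(u in tbox m e t) (ker1 b c z u)%:E)%E.
Proof.
move=> mul e0 em.
have [K K0 hK] := @ker1_tbox_ge m b c e e0 em.
pose L := (4 * e ^+ 2) ^+ m * (2 * e).
have L0 : 0 < L by rewrite !mulr_gt0// exprn_gt0// mulr_gt0// exprn_gt0.
exists (K * L); first exact: mulr_gt0.
move=> s t z s0 st zb; have t0 := lt_le_trans s0 st.
have mk : measurable_fun [set: Cn R m.+1] (fun u => (ker1 b c z u)%:E).
  by apply/measurable_EFinP; exact: measurable_ker1.
have mB : measurable (tbox m e t) by exact: measurable_tbox.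
apply: (@le_trans _ _ (\int[mu]_(u in tbox m e t) (cst (K * t `^ (b - c))%:E u))%E).
  rewrite integral_cst// [X in (_ * X)%E]lebesgue_tbox// -/L -EFinM lee_fin.
  by rewrite mulrACA -powRD ?(gt_eqF t0) ?implybT.
apply: ge0_le_integral => //.
- by move=> u _; rewrite /= lee_fin mulr_ge0 ?powR_ge0 ?(ltW K0).
- exact: measurable_funTS.
- by move=> u ub; rewrite /= lee_fin; exact: (hK s).
Qed.

(** Rules out 0 * +oo when finiteness of I_1(z) I_2(w) is to give finiteness of each factor. *)
Lemma integral_ker1_gt0 m (mu : {measure set Cn R m.+1 -> \bar R}) b c e z :
  is_lebesgue mu -> 0 < e -> m.+1%:R * e <= 12^-1 -> tbox m e 1 z ->
  (0 < \int[mu]_(u in @TB R m.+1) (ker1 b c z u)%:E)%E.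
Proof.
move=> mul e0 em zb.
have [K K0 hK] := @integral_ker1_tbox_ge m mu b c e mul e0 em.
apply: (@lt_le_trans _ _ (\int[mu]_(u in tbox m e 1) (ker1 b c z u)%:E)%E).
  apply: lt_le_trans (hK 1 1 z ltr01 (lexx _) zb).
  by rewrite lte_fin powR1 mulr1.
apply: ge0_subset_integral => //.
- exact: measurable_tbox.
- exact: measurable_TB.
- by apply: measurable_funTS; apply/measurable_EFinP; exact: measurable_ker1.
- by move=> u _; rewrite lee_fin ker1_ge0.
- by move=> u; exact: tbox_TB.
Qed.

(* The boxes of sizes 4^k are disjoint, and each contributes at least a fixed amount. *)
Lemma integral_ker1_tbox_infty m (mu : {measure set Cn R m.+1 -> \bar R}) b c e z :
  is_lebesgue mu -> 0 < e -> m.+1%:R * e <= 12^-1 -> tbox m e 1 z ->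
  c <= m.+1%:R + 1 + b ->
  (\int[mu]_(u in @TB R m.+1) (ker1 b c z u)%:E = +oo)%E.
Proof.
move=> mul e0 em zb cb.
have [K K0 hK] := @integral_ker1_tbox_ge m mu b c e mul e0 em.
pose F (k : nat) := tbox m e (4 ^+ k).
have p4 k : 1 <= 4 ^+ k :> R by rewrite exprn_ege1// ler1n.
have mF k : measurable (F k) by exact: measurable_tbox.
have FTB k : F k `<=` @TB R m.+1.
  by move=> u; apply: tbox_TB => //; rewrite exprn_gt0.
have mk : measurable_fun [set: Cn R m.+1] (fun u => (ker1 b c z u)%:E).
  by apply/measurable_EFinP; exact: measurable_ker1.
have lower k : (K%:E <= \int[mu]_(u in F k) (ker1 b c z u)%:E)%E.
  apply: le_trans (hK 1 _ z ltr01 (p4 k) zb).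
  rewrite lee_fin; apply: ler_peMr; first exact: ltW.
  by rewrite -[leLHS](powRr0 (4 ^+ k)) ler_powR//; lra.
apply: eq_infty => M.
apply: (@le_trans _ _ (\int[mu]_(u in \bigcup_k F k) (ker1 b c z u)%:E)%E); last first.
  apply: ge0_subset_integral => //.
  - exact: bigcupT_measurable.
  - exact: measurable_TB.
  - exact: measurable_funTS.
  - by move=> u _; rewrite lee_fin ker1_ge0.
  - exact: bigcup_sub.
rewrite ge0_integral_bigcup//; last 3 first.
- exact: measurable_funTS.
- by move=> u _; rewrite lee_fin ker1_ge0.
- apply/trivIsetP => /= i j _ _; wlog ij : i j / (i < j)%N.
    move=> wl; rewrite neq_ltn => /orP[ij|ij]; first by apply: wl => //; rewrite ltn_eqF.
    by rewrite setIC; apply: wl => //; rewrite ltn_eqF.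
  (* Only heights matter: [4^i, 2 * 4^i] ends strictly before 4^j, whereas powers of 2 would let
     closed boxes touch. *)
  move=> _; apply/seteqP; split => // u [/tboxP[_ [_ /andP[_ h1]]] /tboxP[_ [_ /andP[h2 _]]]].
  have : 4 * 4 ^+ i <= 4 ^+ j :> R by rewrite -exprS ler_weXn2l// ler1n.
  have := p4 i; lra.
pose N := (Num.truncn (M / K)).+1.
apply: (@le_trans _ _ (\sum_(0 <= k < N) \int[mu]_(u in F k) (ker1 b c z u)%:E)%E); last first.
  by apply: nneseries_lim_ge => k *; apply: integral_ge0 => u _; rewrite lee_fin ker1_ge0.
apply: (@le_trans _ _ (\sum_(0 <= k < N) K%:E)%E); last first.
  by apply: lee_sum => k _; exact: lower.
rewrite sumEFin lee_fin sumr_const_nat subn0 -[_ *+ N]mulr_natl.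
by rewrite -ler_pdivrMr// ltW// truncnS_gt.
Qed.

End boxes.
Arguments tbox {R} m e t.

(** * Measurability of parametric integrals, products, almost-everywhere statements *)

Section parametric_integrals.
Context d1 d2 (T1 : measurableType d1) (T2 : measurableType d2) (R : realType).

Lemma measurable_fun_section (D1 : set T1) (D2 : set T2) (H : T1 * T2 -> R) (x : T1) :
  measurable D1 -> measurable D2 -> measurable_fun (D1 `*` D2) H -> D1 x ->
  measurable_fun D2 (fun y => H (x, y)).
Proof.
move=> mD1 mD2 mH D1x.
have mg : measurable_fun setT (H \_ (D1 `*` D2)).
  by apply/(measurable_restrictT _ _).1 => //; exact: measurableX.
apply: (eq_measurable_fun (fun y => (H \_ (D1 `*` D2)) (x, y))).
  by move=> y; rewrite inE => D2y; rewrite patchE mem_set.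
by apply: measurable_funTS; exact: (measurableT_comp mg (pair1_measurable x)).
Qed.

(** Tonelli makes the integrals of the positive and negative parts measurable separately; their
    difference, passed through [fine], is then measurable whatever values it takes. *)
Lemma measurable_fun_Rintegral (nu : {sigma_finite_measure set T2 -> \bar R})
    (D1 : set T1) (D2 : set T2) (H : T1 * T2 -> R) :
  measurable D1 -> measurable D2 -> measurable_fun (D1 `*` D2) H ->
  measurable_fun D1 (fun x => Rintegral nu D2 (fun y => H (x, y))).
Proof.
move=> mD1 mD2 mH.
pose g : T1 * T2 -> \bar R := (EFin \o H) \_ (D1 `*` D2).
have mg : measurable_fun setT g.
  apply/(measurable_restrictT _ _).1; first exact: measurableX.
  exact/measurable_EFinP.
apply: (eq_measurable_fun (fun x => fine (\int[nu]_y g^\+ (x, y) - \int[nu]_y g^\- (x, y))%E)).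
  move=> x; rewrite inE => D1x; rewrite /Rintegral; congr fine.
  rewrite [RHS]integral_mkcond [RHS]integralE; congr (_ - _)%E.
    apply: eq_integral => y _; rewrite !funeposE /g !patchE; congr maxe.
    by rewrite in_setX mem_set.
  apply: eq_integral => y _; rewrite !funenegE /g !patchE; congr (maxe (- _) _)%E.
  by rewrite in_setX mem_set.
apply: measurable_funTS; apply: measurableT_comp => //; apply: emeasurable_funB.
  by apply: (@measurable_fun_fubini_tonelli_F _ _ _ _ _ nu g^\+%E) => //; exact: measurable_funepos.
by apply: (@measurable_fun_fubini_tonelli_F _ _ _ _ _ nu g^\-%E) => //; exact: measurable_funeneg.
Qed.

Lemma measurable_fun_snd_on (D1 : set T1) (D2 : set T2) (f : T2 -> R) :
  measurable D1 -> measurable D2 -> measurable_fun D2 f ->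
  measurable_fun (D1 `*` D2) (fun q => f q.2).
Proof.
move=> mD1 mD2 mf; apply: (@measurable_comp _ _ _ _ _ _ D2 f _ snd) => //.
  by move=> _ [q [_ ?] <-].
exact: measurable_funTS.
Qed.

Lemma integral_prod (m1 : {sigma_finite_measure set T1 -> \bar R})
  (m2 : {sigma_finite_measure set T2 -> \bar R}) (D1 : set T1) (D2 : set T2)
  (f : T1 -> R) (g : T2 -> R) :
  measurable D1 -> measurable D2 -> measurable_fun setT f -> measurable_fun setT g ->
  (forall x, 0 <= f x) -> (forall y, 0 <= g y) ->
  (\int[m1 \x m2]_(q in D1 `*` D2) (f q.1 * g q.2)%:E =
   (\int[m1]_(x in D1) (f x)%:E) * (\int[m2]_(y in D2) (g y)%:E))%E.
Proof.
move=> mD1 mD2 mf mg f0 g0.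
pose F := (EFin \o f) \_ D1; pose G := (EFin \o g) \_ D2.
have mF : measurable_fun setT F.
  by apply/(measurable_restrictT _ _).1 => //; apply/measurable_EFinP; exact: measurable_funTS.
have mG : measurable_fun setT G.
  by apply/(measurable_restrictT _ _).1 => //; apply/measurable_EFinP; exact: measurable_funTS.
have F0 x : (0 <= F x)%E by apply: erestrict_ge0 => ? _; rewrite lee_fin.
have G0 y : (0 <= G y)%E by apply: erestrict_ge0 => ? _; rewrite lee_fin.
rewrite integral_mkcond.
rewrite (_ : _ \_ _ = fun q => (F q.1 * G q.2)%E); last first.
  apply/funext => -[x y]; rewrite /F /G !patchE in_setX /=.
  by case: (x \in D1); case: (y \in D2); rewrite /= ?mule0 ?mul0e.
rewrite fubini_tonelli1//; last 2 first.
- by apply: emeasurable_funM; [exact: (measurableT_comp mF)|exact: (measurableT_comp mG)].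
- by move=> q; exact: mule_ge0.
rewrite /fubini_F /=.
under eq_integral => x _ do rewrite ge0_integralZl//.
rewrite ge0_integralZr//; last exact: integral_ge0.
by rewrite [in RHS]integral_mkcond [in RHS](integral_mkcond D2).
Qed.

Lemma mule_lty_neqy (x y : \bar R) : (0 < x)%E -> (0 < y)%E ->
  (x * y < +oo)%E -> x <> +oo%E /\ y <> +oo%E.
Proof.
move=> x0 y0 xy; split => h; move: xy; rewrite h.
  by rewrite gt0_mulye.
by rewrite gt0_muley.
Qed.

(** Turns the almost-everywhere conclusions of [bounded_Linf] into one good point inside a test
    box. *)
Lemma ae_exists (m : {measure set T1 -> \bar R}) (E : set T1) (Q : T1 -> Prop) :
  measurable E -> (0 < m E)%E -> {ae m, forall x, E x -> Q x} -> exists2 x, E x & Q x.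
Proof.
move=> mE mE0 [N [mN N0 QN]]; apply: contrapT => nex.
have EN : E `<=` N.
  by move=> x Ex; apply: QN => /= Qx; apply: nex; exists x => //; exact: Qx.
have : (m E <= m N)%E by apply: le_measure; rewrite ?inE.
by rewrite N0 leNgt mE0.
Qed.

End parametric_integrals.

(** * The equivalence for a kernel that is the common modulus times a phase *)

Section phase_kernels.
Variables (R : realType) (m : nat).
Variable mu : {sigma_finite_measure set Cn R m.+1 -> \bar R}.
Hypothesis mul : is_lebesgue mu.
Variables a b c : R * R.
Local Notation P := (Cn R m.+1 * Cn R m.+1)%type.
Local Notation mu2 := (mu \x mu)%E.
Local Notation D := (@TB R m.+1 `*` @TB R m.+1).
Implicit Types (p q : P) (f : P -> R[i]) (M : R).

Definition skernel p q : R :=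
  (rho p.1 `^ a.1 * rho p.2 `^ a.2 * rho q.1 `^ b.1 * rho q.2 `^ b.2)
   / (cabs (rho2 p.1 q.1) `^ c.1 * cabs (rho2 p.2 q.2) `^ c.2).

Lemma skernelE p q : skernel p q = (rho p.1 `^ a.1 * rho p.2 `^ a.2) *
  (ker1 b.1 c.1 p.1 q.1 * ker1 b.2 c.2 p.2 q.2).
Proof. by rewrite /skernel /ker1 mulf_div !mulrA. Qed.

Lemma skernel_ge0 p q : 0 <= skernel p q.
Proof.
rewrite skernelE; apply: mulr_ge0; first by apply: mulr_ge0; exact: powR_ge0.
by apply: mulr_ge0; exact: ker1_ge0.
Qed.

(** [KE] and [mth] serve the upper bound, where only measurability of the phase matters; [th_le]
    serves the lower bounds, making the phase small wherever both arguments are. *)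
Variables (K : P -> P -> R[i]) (th : P * P -> R).
Hypothesis KE : forall p q, D p -> D q ->
  K p q = (skernel p q)%:C%C * Complex (cos (th (p, q))) (sin (th (p, q))).
Hypothesis mth : measurable_fun (D `*` D) th.
Hypothesis th_le : forall p q, D p -> D q ->
  `|th (p, q)| <= `|c.1| * `|Arg (rho2 p.1 q.1)| + `|c.2| * `|Arg (rho2 p.2 q.2)|.

Let mD : measurable D.
Proof. by apply: measurableX; exact: measurable_TB. Qed.

Lemma measurable_skernel : measurable_fun [set: P * P] (fun x => skernel x.1 x.2).
Proof.
under eq_fun do rewrite skernelE.
have mfst2 : measurable_fun [set: P * P] (fun x => x.1.1).
  exact: measurableT_comp.
have msnd2 : measurable_fun [set: P * P] (fun x => x.1.2).
  exact: measurableT_comp.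
have mr : measurable_fun [set: Cn R m.+1] (@rho R m.+1) by exact: measurable_rho.
apply: measurable_funM; apply: measurable_funM.
- exact: (measurableT_comp (measurable_powR _) (measurableT_comp mr mfst2)).
- exact: (measurableT_comp (measurable_powR _) (measurableT_comp mr msnd2)).
- apply: (@measurableT_comp _ _ _ _ _ _ (fun q : P => ker1 b.1 c.1 q.1 q.2) _
    (fun x : P * P => (x.1.1, x.2.1))); first exact: measurable_ker1_pair.
  by apply: measurable_fun_pair => //; exact: measurableT_comp.
- apply: (@measurableT_comp _ _ _ _ _ _ (fun q : P => ker1 b.2 c.2 q.1 q.2) _
    (fun x : P * P => (x.1.2, x.2.2))); first exact: measurable_ker1_pair.
  by apply: measurable_fun_pair => //; exact: measurableT_comp.
Qed.

Lemma Re_KfE f p q : D p -> D q -> complex.Re (K p q * f q) =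
  skernel p q * (cos (th (p, q)) * complex.Re (f q) - sin (th (p, q)) * complex.Im (f q)).
Proof. by move=> Dp Dq; rewrite KE//; case: (f q) => x y /=; ring. Qed.

Lemma Im_KfE f p q : D p -> D q -> complex.Im (K p q * f q) =
  skernel p q * (cos (th (p, q)) * complex.Im (f q) + sin (th (p, q)) * complex.Re (f q)).
Proof. by move=> Dp Dq; rewrite KE//; case: (f q) => x y /=; ring. Qed.

Let mcos : measurable_fun (D `*` D) (fun x => cos (th x)).
Proof.
apply: (measurableT_comp _ mth); apply: continuous_measurable_fun; exact: continuous_cos.
Qed.

Let msin : measurable_fun (D `*` D) (fun x => sin (th x)).
Proof.
apply: (measurableT_comp _ mth); apply: continuous_measurable_fun; exact: continuous_sin.
Qed.

Let msk : measurable_fun (D `*` D) (fun x => skernel x.1 x.2).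
Proof. exact: measurable_funTS measurable_skernel. Qed.

Lemma measurable_Re_Kf f : cmeasurable f ->
  measurable_fun (D `*` D) (fun x : P * P => complex.Re (K x.1 x.2 * f x.2)).
Proof.
move=> [mr mi].
have mr2 := measurable_fun_snd_on mD mD mr.
have mi2 := measurable_fun_snd_on mD mD mi.
apply: (eq_measurable_fun (fun x : P * P => skernel x.1 x.2 *
   (cos (th x) * complex.Re (f x.2) - sin (th x) * complex.Im (f x.2)))).
  by move=> [p q]; rewrite inE => -[Dp Dq]; rewrite /= Re_KfE.
by apply: measurable_funM => //; apply: measurable_funB; exact: measurable_funM.
Qed.

Lemma measurable_Im_Kf f : cmeasurable f ->
  measurable_fun (D `*` D) (fun x : P * P => complex.Im (K x.1 x.2 * f x.2)).
Proof.
move=> [mr mi].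
have mr2 := measurable_fun_snd_on mD mD mr.
have mi2 := measurable_fun_snd_on mD mD mi.
apply: (eq_measurable_fun (fun x : P * P => skernel x.1 x.2 *
   (cos (th x) * complex.Im (f x.2) + sin (th x) * complex.Re (f x.2)))).
  by move=> [p q]; rewrite inE => -[Dp Dq]; rewrite /= Im_KfE.
by apply: measurable_funM => //; apply: measurable_funD; exact: measurable_funM.
Qed.

Lemma cmeasurable_intop f : cmeasurable f -> cmeasurable (intop mu K f).
Proof.
move=> mf; split; rewrite /intop /=.
  exact: (measurable_fun_Rintegral (sfprod mu mu) mD mD (measurable_Re_Kf mf)).
exact: (measurable_fun_Rintegral (sfprod mu mu) mD mD (measurable_Im_Kf mf)).
Qed.

Lemma integral_skernel p :
  (\int[mu2]_(q in D) (skernel p q)%:E = (rho p.1 `^ a.1 * rho p.2 `^ a.2)%:E *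
   (\int[mu]_(u in @TB R m.+1) (ker1 b.1 c.1 p.1 u)%:E *
    \int[mu]_(u in @TB R m.+1) (ker1 b.2 c.2 p.2 u)%:E))%E.
Proof.
have k0 i j z u : 0 <= @ker1 R m.+1 i j z u by exact: ker1_ge0.
rewrite -integral_prod//; last 4 first.
- exact: measurable_TB.
- exact: measurable_TB.
- exact: measurable_ker1.
- exact: measurable_ker1.
under eq_integral do rewrite skernelE EFinM.
rewrite ge0_integralZl//.
- apply/measurable_EFinP; apply: measurable_funTS; apply: measurable_funM.
    by apply: measurableT_comp; first exact: measurable_ker1.
  by apply: measurableT_comp; first exact: measurable_ker1.
- by move=> q _; rewrite lee_fin mulr_ge0.
- by rewrite lee_fin mulr_ge0 ?powR_ge0.
Qed.

(** * Sufficiency: a uniform bound on the integral of the modulus *)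

Section sufficiency.
Variable C : R.
Hypothesis C0 : 0 <= C.
Hypothesis intC : forall p, D p -> (\int[mu2]_(q in D) (skernel p q)%:E <= C%:E)%E.

Let measurable_skernel_section p : measurable_fun D (skernel p).
Proof.
apply: measurable_funTS.
exact: (measurableT_comp measurable_skernel (pair1_measurable p)).
Qed.

(** [g] stands for the real or the imaginary part. *)
Lemma integral_Kf_le (g : R[i] -> R) f M p :
  (forall w, `|g w| <= cabs w) ->
  measurable_fun D (fun q => g (K p q * f q)) ->
  D p -> 0 <= M -> ae_bounded mu f M ->
  (\int[mu2]_(q in D) `|(g (K p q * f q))%:E| <= (C * M)%:E)%E.
Proof.
move=> gle mg Dp M0 fM.
apply: (@le_trans _ _ (\int[mu2]_(q in D) (M%:E * (skernel p q)%:E))%E).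
  apply: ae_ge0_le_integral => //.
  - by apply: measurableT_comp => //; exact/measurable_EFinP.
  - by move=> q _; rewrite mule_ge0// lee_fin skernel_ge0.
  - by apply: measurable_funeM; apply/measurable_EFinP; exact: measurable_skernel_section.
  - apply: filterS fM => q fq Dq.
    rewrite -EFinM abse_EFin lee_fin; apply: (le_trans (gle _)).
    rewrite cabsM KE// cabs_polar ?skernel_ge0// mulrC ler_wpM2r ?skernel_ge0//.
    exact: fq.
rewrite ge0_integralZl//; last 2 first.
- by apply/measurable_EFinP; exact: measurable_skernel_section.
- by move=> q _; rewrite lee_fin skernel_ge0.
by rewrite mulrC EFinM lee_wpmul2l// ?lee_fin// intC.
Qed.

Lemma Rintegral_Kf_le (g : R[i] -> R) f M p :
  (forall w, `|g w| <= cabs w) ->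
  measurable_fun D (fun q => g (K p q * f q)) ->
  D p -> 0 <= M -> ae_bounded mu f M ->
  mu2.-integrable D (fun q => (g (K p q * f q))%:E) /\
  `|Rintegral mu2 D (fun q => g (K p q * f q))| <= C * M.
Proof.
move=> gle mg Dp M0 fM.
have le := integral_Kf_le gle mg Dp M0 fM.
have int : mu2.-integrable D (fun q => (g (K p q * f q))%:E).
  apply/integrableP; split; first exact/measurable_EFinP.
  by apply: (le_lt_trans le); rewrite ltry.
split => //; rewrite -lee_fin -abse_EFin /Rintegral fineK; last exact: integrable_fin_num.
by apply: le_trans le; apply: le_abse_integral => //; exact/measurable_EFinP.
Qed.

(** Pulling the essential bound of f out of the integral leaves at most C; the real and imaginary
    parts are estimated separately, which gives 2 C. *)
Lemma bounded_of_integral_bound : bounded_Linf mu K.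
Proof.
exists (2 * C) => f [mf [M fM]].
have mRe p : D p -> measurable_fun D (fun q => complex.Re (K p q * f q)).
  by move=> Dp; exact: (measurable_fun_section mD mD (measurable_Re_Kf mf) Dp).
have mIm p : D p -> measurable_fun D (fun q => complex.Im (K p q * f q)).
  by move=> Dp; exact: (measurable_fun_section mD mD (measurable_Im_Kf mf) Dp).
have fM' : ae_bounded mu f (Num.max M 0).
  by apply: filterS fM => q fq Dq; rewrite le_max fq.
have M0 : 0 <= Num.max M 0 by rewrite le_max lexx orbT.
split.
  apply: aeW => p Dp; split.
    by have [] := Rintegral_Kf_le (@Re_le_cabs R) (mRe p Dp) Dp M0 fM'.
  by have [] := Rintegral_Kf_le (@Im_le_cabs R) (mIm p Dp) Dp M0 fM'.
split; first exact: cmeasurable_intop.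
(* [ae_bounded] admits a negative bound; at a point of D it contradicts nonnegativity of the
   modulus. *)
move=> M1 fM1; have [M10|M10] := leP 0 M1; last first.
  apply: filterS fM1 => q fq Dq; have := fq Dq; have := cabs_ge0 (f q).
  lra.
apply: aeW => p Dp.
have [_ h1] := Rintegral_Kf_le (@Re_le_cabs R) (mRe p Dp) Dp M10 fM1.
have [_ h2] := Rintegral_Kf_le (@Im_le_cabs R) (mIm p Dp) Dp M10 fM1.
have -> : 2 * C * M1 = C * M1 + C * M1 by ring.
exact: cabs_le.
Qed.

End sufficiency.

Lemma phase_kernel_bounded :
  [/\ 0 < a.1, -1 < b.1 & c.1 = m.+1%:R + 1 + a.1 + b.1] ->
  [/\ 0 < a.2, -1 < b.2 & c.2 = m.+1%:R + 1 + a.2 + b.2] -> bounded_Linf mu K.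
Proof.
move=> [a1 b1 c1] [a2 b2 c2].
have [K1 K10 h1] := integral_ker1_le mul a1 b1 c1.
have [K2 K20 h2] := integral_ker1_le mul a2 b2 c2.
apply: (@bounded_of_integral_bound (K1 * K2)) => // p [p1 p2].
have /TBE r1 := p1; have /TBE r2 := p2.
rewrite integral_skernel.
have i0 i j (z : Cn R m.+1) : (0 <= \int[mu]_(u in @TB R m.+1) (ker1 i j z u)%:E)%E.
  by apply: integral_ge0 => u _; rewrite lee_fin ker1_ge0.
apply: (@le_trans _ _ ((rho p.1 `^ a.1 * rho p.2 `^ a.2)%:E *
  ((K1 * rho p.1 `^ (- a.1))%:E * (K2 * rho p.2 `^ (- a.2))%:E))%E).
  apply: lee_wpmul2l; first by rewrite lee_fin mulr_ge0 ?powR_ge0.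
  by apply: lee_pmul => //; [exact: h1|exact: h2].
(* The weights rho^a cancel rho^(-a) exactly, which leaves the constant K1 * K2. *)
rewrite -!EFinM lee_fin !powRN.
have g1 : rho p.1 `^ a.1 != 0 by rewrite gt_eqF// powR_gt0.
have g2 : rho p.2 `^ a.2 != 0 by rewrite gt_eqF// powR_gt0.
rewrite le_eqVlt; apply/orP; left; apply/eqP; field; by rewrite g1 g2.
Qed.

(** On boxes of aperture e the tangent of each argument is at most 8 e. Continuity of [atan] at 0
    makes the arguments at most 1/N, with N = 1 + |c1| + |c2|, so the phase is at most 1; [d / 16]
    ensures 8 e < d. *)
Lemma tbox_small_phase : exists e : R, [/\ 0 < e, m.+1%:R * e <= 12^-1 &
  forall t1 t2 p q, 0 < t1 -> 0 < t2 ->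
  (tbox m e t1 `*` tbox m e t2) p -> (tbox m e t1 `*` tbox m e t2) q ->
  cos 1 <= cos (th (p, q))].
Proof.
pose N := 1 + `|c.1| + `|c.2|.
have N0 : 0 < N by have := normr_ge0 c.1; have := normr_ge0 c.2; rewrite /N; lra.
have N'0 : 0 < N^-1 by rewrite invr_gt0.
have /cvgrPdist_lt /(_ _ N'0) := @continuous_atan R 0.
move=> /nbhs_ballP[d /= d0 hd].
have m0 : 0 < m.+1%:R :> R by [].
pose e : R := Num.min (d / 16) (12^-1 / m.+1%:R).
have e0 : 0 < e by rewrite /e lt_min !divr_gt0.
have em : m.+1%:R * e <= 12^-1.
  by rewrite mulrC -ler_pdivlMr// /e ge_min lexx orbT.
have ed : 8 * e < d.
  have h : e <= d / 16 by rewrite /e ge_min lexx.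
  lra.
have hA t z u : 0 < t -> tbox m e t z -> tbox m e t u -> `|Arg (rho2 z u)| <= N^-1.
  move=> t0 zb ub; have [r1 _ r2] := tbox_rho2 e0 em t0 (lexx t) zb ub.
  have r0 : 0 < complex.Re (rho2 z u) by apply: lt_le_trans r1; rewrite mulr_gt0.
  rewrite /Arg r0; set x := _ / _.
  have : ball (0 : R) d x.
    by rewrite /ball /= sub0r normrN; exact: le_lt_trans ed.
  by move=> /hd /=; rewrite atan0 sub0r normrN => /ltW.
exists e; split => // t1 t2 p q t10 t20 [p1 p2] [q1 q2].
have Dp : D p by split; [exact: tbox_TB p1|exact: tbox_TB p2].
have Dq : D q by split; [exact: tbox_TB q1|exact: tbox_TB q2].
have th1 : `|th (p, q)| <= 1.
  apply: (le_trans (th_le Dp Dq)).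
  apply: (@le_trans _ _ (`|c.1| * N^-1 + `|c.2| * N^-1)).
    by apply: lerD; apply: ler_wpM2l => //; [exact: hA q1|exact: hA q2].
  by rewrite -mulrDl ler_pdivrMr// mul1r /N; lra.
rewrite -[leRHS]cos_norm leNgt ltr_cos ?in_itv/=.
- by rewrite -leNgt.
- by rewrite ler01 (le_trans _ (pi_ge2 R))// ler1n.
- by rewrite normr_ge0 (le_trans th1)// (le_trans _ (pi_ge2 R))// ler1n.
Qed.

(** * Necessity: testing on indicators of boxes and on f = 1 *)

Section necessity.
Hypothesis bK : bounded_Linf mu K.
Variable e : R.
Hypotheses (e0 : 0 < e) (em : m.+1%:R * e <= 12^-1).
Hypothesis cos_ge : forall t1 t2 p q, 0 < t1 -> 0 < t2 ->
  (tbox m e t1 `*` tbox m e t2) p -> (tbox m e t1 `*` tbox m e t2) q ->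
  cos 1 <= cos (th (p, q)).

Let tbox2 t1 t2 := (tbox m e t1 `*` tbox m e t2 : set P).

Let mtbox2 t1 t2 : measurable (tbox2 t1 t2).
Proof. by apply: measurableX; exact: measurable_tbox. Qed.

Let tbox2_D t1 t2 : 0 < t1 -> 0 < t2 -> tbox2 t1 t2 `<=` D.
Proof. by move=> t10 t20 p [p1 p2]; split; [exact: tbox_TB p1|exact: tbox_TB p2]. Qed.

Let L := (4 * e ^+ 2) ^+ m * (2 * e).

Let L0 : 0 < L.
Proof. by rewrite !mulr_gt0// exprn_gt0// mulr_gt0// exprn_gt0. Qed.

Let mu_tbox2 t1 t2 : 0 < t1 -> 0 < t2 ->
  mu2 (tbox2 t1 t2) = (L * t1 `^ (m.+1%:R + 1) * (L * t2 `^ (m.+1%:R + 1)))%:E.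
Proof.
move=> t10 t20; rewrite [LHS]product_measure1E; [|exact: measurable_tbox|exact: measurable_tbox].
by rewrite EFinM; congr (_ * _)%E; exact: lebesgue_tbox.
Qed.

Let mu_tbox2_gt0 t1 t2 : 0 < t1 -> 0 < t2 -> (0 < mu2 (tbox2 t1 t2))%E.
Proof.
move=> t10 t20; rewrite mu_tbox2// lte_fin.
by apply: mulr_gt0; apply: mulr_gt0 => //; exact: powR_gt0.
Qed.

Let Linf_indic (E : set P) : measurable E ->
  Linf mu (fun q => (\1_E q)%:C%C) /\ ae_bounded mu (fun q => (\1_E q)%:C%C) 1.
Proof.
move=> mE.
have b1 : ae_bounded mu (fun q => (\1_E q)%:C%C) 1.
  apply: aeW => q _; rewrite /cabs /= expr0n/= addr0 sqrtr_sqr indicE.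
  by case: (q \in E); rewrite ?normr1 ?normr0.
split => //; split; last by exists 1.
split => /=; last exact: measurable_cst.
by apply: measurable_funTS; exact: measurable_indic.
Qed.

(** At a point of the box E no cancellation occurs, so the real part of the integral is at least the
    least value of the integrand times the volume of E: the former gives the exponents a + b - c,
    the latter adds n + 1. All indicators have norm at most 1, so one C serves for all sizes. *)
Lemma scaling_bound : exists2 k : R, 0 < k & exists C : R, forall t1 t2 : R, 0 < t1 -> 0 < t2 ->
  k * (t1 `^ (a.1 + b.1 - c.1 + (m.+1%:R + 1)) *
       t2 `^ (a.2 + b.2 - c.2 + (m.+1%:R + 1))) <= C.
Proof.
have [C hC] := bK.
have [K1 K10 h1] := @ker1_tbox_ge R m b.1 c.1 e e0 em.
have [K2 K20 h2] := @ker1_tbox_ge R m b.2 c.2 e e0 em.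
pose A1 : R := Num.min (2^-1 `^ a.1) (2 `^ a.1).
pose A2 : R := Num.min (2^-1 `^ a.2) (2 `^ a.2).
have A10 : 0 < A1 by rewrite lt_min !powR_gt0.
have A20 : 0 < A2 by rewrite lt_min !powR_gt0.
exists (A1 * A2 * (K1 * K2) * cos 1 * (L * L)).
  apply: mulr_gt0; last exact: mulr_gt0.
  by apply: mulr_gt0; [apply: mulr_gt0; exact: mulr_gt0|exact: cos1_gt0].
exists C => t1 t2 t10 t20.
pose E := tbox2 t1 t2.
have mE : measurable E by exact: mtbox2.
have [lf bf] := Linf_indic (mtbox2 t1 t2).
have [cv [_ /(_ _ bf) bd]] := hC _ lf.
(* E has positive measure, so the almost-everywhere statements hold at some point of it. *)
have [p Ep [cvp bdp]] : exists2 p, E p &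
    converges_at mu K (fun q => (\1_E q)%:C%C) p /\
    cabs (intop mu K (fun q => (\1_E q)%:C%C) p) <= C.
  apply: (@ae_exists _ _ _ mu2 E _ (mtbox2 t1 t2) (mu_tbox2_gt0 t10 t20)).
  apply: filterS2 cv bd => p cvp bdp Ep.
  have Dp : D p by exact: tbox2_D Ep.
  by split; [exact: cvp|rewrite -[C]mulr1; exact: bdp].
have Dp : D p by exact: tbox2_D Ep.
apply: le_trans bdp; apply: le_trans (cabs_ge_Re _); rewrite /intop /=.
have [cvR _] := cvp.
pose k := A1 * A2 * (K1 * K2) * cos 1 *
  (t1 `^ (a.1 + b.1 - c.1) * t2 `^ (a.2 + b.2 - c.2)).
have k0 : 0 <= k.
  apply: mulr_ge0; last by apply: mulr_ge0; exact: powR_ge0.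
  apply: mulr_ge0; last exact: ltW (cos1_gt0 R).
  by apply: mulr_ge0; apply: ltW; exact: mulr_gt0.
have kle q : E q -> k <= complex.Re (K p q * (\1_E q)%:C%C).
  move=> Eq; have Dq : D q by exact: tbox2_D Eq.
  rewrite (Re_KfE (fun q => (\1_E q)%:C%C))//= indicE mem_set//= mulr1 mulr0 subr0.
  have [p1 p2] := Ep; have [q1 q2] := Eq.
  have /andP[r1 r1'] := tbox_rho e0 em t10 p1.
  have /andP[r2 r2'] := tbox_rho e0 em t20 p2.
  have half0 : 0 < 2^-1 :> R by [].
  have s1 := powR_scale_min a.1 half0 (ltr0Sn R 1) t10 r1 r1'.
  have s2 := powR_scale_min a.2 half0 (ltr0Sn R 1) t20 r2 r2'.
  have u1 := h1 t1 t1 p.1 t10 (lexx _) p1 q.1 q1.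
  have u2 := h2 t2 t2 p.2 t20 (lexx _) p2 q.2 q2.
  rewrite skernelE.
  have -> : k = (A1 * t1 `^ a.1 * (A2 * t2 `^ a.2)) *
      ((K1 * t1 `^ (b.1 - c.1)) * (K2 * t2 `^ (b.2 - c.2))) * cos 1.
    rewrite /k -!addrA !(@powRD _ _ _ (_ - _)) ?(gt_eqF t10) ?(gt_eqF t20) ?implybT//.
    ring.
  have nn1 : 0 <= A1 * t1 `^ a.1 by rewrite mulr_ge0 ?powR_ge0 ?(ltW A10).
  have nn2 : 0 <= A2 * t2 `^ a.2 by rewrite mulr_ge0 ?powR_ge0 ?(ltW A20).
  have nn3 : 0 <= K1 * t1 `^ (b.1 - c.1) by rewrite mulr_ge0 ?powR_ge0 ?(ltW K10).
  have nn4 : 0 <= K2 * t2 `^ (b.2 - c.2) by rewrite mulr_ge0 ?powR_ge0 ?(ltW K20).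
  apply: ler_pM; [by apply: mulr_ge0; exact: mulr_ge0|exact: ltW (cos1_gt0 R)|
                 |exact: cos_ge Ep Eq].
  apply: ler_pM; [exact: mulr_ge0|exact: mulr_ge0| |].
    exact: (ler_pM nn1 nn2 s1 s2).
  exact: (ler_pM nn3 nn4 u1 u2).
(* Nonnegativity on all of D allows the domain of integration to shrink from D to E. *)
have Re0 q : D q -> 0 <= complex.Re (K p q * (\1_E q)%:C%C).
  move=> Dq; have [Eq|nEq] := pselect (E q); first exact: le_trans (kle q Eq).
  by rewrite indicE memNset//= mulr0.
have mR := measurable_int _ cvR.
rewrite -lee_fin /Rintegral fineK; last exact: integrable_fin_num.
apply: (@le_trans _ _ (\int[mu2]_(q in E) (complex.Re (K p q * (\1_E q)%:C%C))%:E)%E); last first.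
  by apply: ge0_subset_integral => //; exact: tbox2_D.
apply: (@le_trans _ _ (\int[mu2]_(q in E) cst k%:E q)%E); last first.
  apply: ge0_le_integral => //.
  by apply: measurable_funS mR => //; exact: tbox2_D.
rewrite integral_cst// [X in (_ * X)%E]mu_tbox2// -EFinM lee_fin /k.
rewrite !(@powRD _ _ _ (m.+1%:R + 1)) ?(gt_eqF t10) ?(gt_eqF t20) ?implybT//.
rewrite le_eqVlt; apply/orP; left; apply/eqP; ring.
Qed.

(** The modulus of the kernel is at most |Re| + |Im|, both integrable at p, so the phase disappears
    and Tonelli splits the integral. The point is taken in the boxes of size 1, from which the
    divergence estimates start. *)
Lemma finite_integrals : exists2 p, tbox2 1 1 p &
  (\int[mu]_(u in @TB R m.+1) (ker1 b.1 c.1 p.1 u)%:E *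
   \int[mu]_(u in @TB R m.+1) (ker1 b.2 c.2 p.2 u)%:E < +oo)%E.
Proof.
have [C hC] := bK.
have [lf _] := Linf_indic (@measurableT _ P).
have [cv _] := hC _ lf.
have [p Ep [cvR cvI]] : exists2 p, tbox2 1 1 p &
    converges_at mu K (fun q => (\1_[set: P] q)%:C%C) p.
  apply: (@ae_exists _ _ _ mu2 (tbox2 1 1)) => //; first exact: mu_tbox2_gt0.
  by apply: filterS cv => p cvp Ep; apply: cvp; exact: tbox2_D Ep.
have Dp : D p by exact: tbox2_D Ep.
exists p => //.
have /TBE r1 := Dp.1; have /TBE r2 := Dp.2.
have fin : (\int[mu2]_(q in D) (skernel p q)%:E < +oo)%E.
  have [mR iR] := (integrableP _ _ _ cvR); have [mI iI] := (integrableP _ _ _ cvI).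
  apply: (@le_lt_trans _ _ (\int[mu2]_(q in D) (`|(complex.Re (K p q * (\1_[set: P] q)%:C%C))%:E| +
     `|(complex.Im (K p q * (\1_[set: P] q)%:C%C))%:E|))%E).
    apply: ge0_le_integral => //.
    - by move=> q _; rewrite lee_fin skernel_ge0.
    - apply/measurable_EFinP; apply: measurable_funTS.
      exact: (measurableT_comp measurable_skernel (pair1_measurable p)).
    - by apply: emeasurable_funD; apply: measurableT_comp.
    - move=> q Dq; rewrite !abse_EFin -EFinD lee_fin.
      have <- : cabs (K p q * (\1_[set: P] q)%:C%C) = skernel p q.
        by rewrite indicT KE//= mulr1 cabs_polar ?skernel_ge0.
      exact: cabs_le.
  rewrite ge0_integralD//; [|exact: measurableT_comp|exact: measurableT_comp].
  exact: lte_add_pinfty.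
move: fin; rewrite integral_skernel.
have I0 i j (z : Cn R m.+1) : (0 <= \int[mu]_(u in @TB R m.+1) (ker1 i j z u)%:E)%E.
  by apply: integral_ge0 => u _; rewrite lee_fin ker1_ge0.
have := mule_ge0 (I0 b.1 c.1 p.1) (I0 b.2 c.2 p.2).
(* Were the product infinite, the positive weight in front would keep it so. *)
case: (_ * _)%E => [x| |]// _; first by rewrite !ltry.
by rewrite gt0_muley// lte_fin mulr_gt0// powR_gt0.
Qed.

End necessity.

Lemma phase_kernel_necessary : bounded_Linf mu K ->
  [/\ 0 < a.1, -1 < b.1 & c.1 = m.+1%:R + 1 + a.1 + b.1] /\
  [/\ 0 < a.2, -1 < b.2 & c.2 = m.+1%:R + 1 + a.2 + b.2].
Proof.
move=> bK; have [e [e0 em hcos]] := tbox_small_phase.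
have [k k0 [C hC]] := scaling_bound bK e0 em hcos.
have c1 : c.1 = m.+1%:R + 1 + a.1 + b.1.
  have h : a.1 + b.1 - c.1 + (m.+1%:R + 1) = 0.
    apply: (powR_bounded_exponent0 (C := C) k0) => t t0.
    (* Freezing the other size at 1 isolates one exponent. *)
    by have := hC t 1 t0 ltr01; rewrite powR1 mulr1.
  by rewrite -[c.1]addr0 -h; ring.
have c2 : c.2 = m.+1%:R + 1 + a.2 + b.2.
  have h : a.2 + b.2 - c.2 + (m.+1%:R + 1) = 0.
    apply: (powR_bounded_exponent0 (C := C) k0) => t t0.
    by have := hC 1 t ltr01 t0; rewrite powR1 mul1r.
  by rewrite -[c.2]addr0 -h; ring.
have [p [p1 p2] fin] := finite_integrals bK e0 em.
have p1B : TB p.1 by exact: tbox_TB p1.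
have p2B : TB p.2 by exact: tbox_TB p2.
have i1 := integral_ker1_gt0 b.1 c.1 mul e0 em p1.
have i2 := integral_ker1_gt0 b.2 c.2 mul e0 em p2.
have [ni1 ni2] := mule_lty_neqy i1 i2 fin.
split; split => //; rewrite ltNge; apply/negP => h.
- by apply: ni1; apply: (integral_ker1_tbox_infty mul e0 em p1); rewrite c1; lra.
- by apply: ni1; exact: integral_ker1_infty.
- by apply: ni2; apply: (integral_ker1_tbox_infty mul e0 em p2); rewrite c2; lra.
- by apply: ni2; exact: integral_ker1_infty.
Qed.

End phase_kernels.

(** * Polar form of the kernels of S and T *)

Section phases.
Variables (R : realType) (m : nat).
Local Notation P := (Cn R m.+1 * Cn R m.+1)%type.
Local Notation D := (@TB R m.+1 `*` @TB R m.+1).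

Let cis (t : R) : R[i] := Complex (cos t) (sin t).

Lemma cisD (s t : R) : cis (s + t) = cis s * cis t.
Proof.
rewrite /cis cosD sinD; apply/eqP; rewrite eq_complex /=.
by apply/andP; split; apply/eqP; ring.
Qed.

Lemma cpow_polar (w : R[i]) (c : R) : 0 < cabs w ->
  cpow w c = (cabs w `^ c)%:C%C * cis (c * Arg w).
Proof. by move=> w0; rewrite /cpow /powR gt_eqF. Qed.

Lemma div_polar (x r1 r2 t1 t2 : R) : 0 < r1 -> 0 < r2 ->
  x%:C%C / ((r1%:C%C * cis t1) * (r2%:C%C * cis t2)) =
  (x / (r1 * r2))%:C%C * cis (- (t1 + t2)).
Proof.
move=> r10 r20; have r12 : r1 * r2 != 0 by rewrite mulf_neq0// gt_eqF.
have -> : r1%:C%C * cis t1 * (r2%:C%C * cis t2) = (r1 * r2)%:C%C * cis (t1 + t2).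
  by rewrite cisD rmorphM /=; ring.
have cis0 : cis (t1 + t2) * cis (- (t1 + t2)) = 1.
  by rewrite -cisD subrr /cis cos0 sin0.
have r0 : (r1 * r2)%:C%C != 0 :> R[i].
  by apply/eqP => -[]; exact/eqP.
have c0 : cis (t1 + t2) != 0.
  by apply/eqP => h; move: cis0; rewrite h mul0r => /esym/eqP; rewrite oner_eq0.
rewrite invfM mulrA; congr (_ * _).
  by rewrite -fmorph_div.
by apply: (mulfI c0); rewrite divff.
Qed.

(** Since Re rho(z,u) > 0 on the domain, only the [atan] branch of [Arg] occurs; the quotient is
    written with the power -1 to use measurability of [powR]. *)
Lemma measurable_Arg_rho2 (F : P * P -> Cn R m.+1 * Cn R m.+1) :
  measurable_fun setT F -> (forall x, (D `*` D) x -> TB (F x).1 /\ TB (F x).2) ->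
  measurable_fun (D `*` D) (fun x => Arg (rho2 (F x).1 (F x).2)).
Proof.
move=> mF FD.
apply: (eq_measurable_fun (fun x => atan (complex.Im (rho2 (F x).1 (F x).2) *
    complex.Re (rho2 (F x).1 (F x).2) `^ (-1)))).
  move=> x; rewrite inE => Dx; have [x1 x2] := FD _ Dx.
  have r0 := Re_rho2_gt0 x1 x2.
  by rewrite /Arg r0 powR_inv1 ?(ltW r0).
apply: measurable_funTS.
apply: (@measurableT_comp _ _ _ _ _ _ (@atan R)).
  by apply: continuous_measurable_fun => x; exact: continuous_atan.
apply: measurable_funM; first exact: (measurableT_comp (@measurable_Im_rho2 R m.+1) mF).
apply: (measurableT_comp (measurable_powR _)).
exact: (measurableT_comp (@measurable_Re_rho2 R m.+1) mF).
Qed.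

Variables (mu : {sigma_finite_measure set Cn R m.+1 -> \bar R}) (a b c : R * R).
Hypothesis mul : is_lebesgue mu.

Let cond := [/\ 0 < a.1, -1 < b.1 & c.1 = m.+1%:R + 1 + a.1 + b.1] /\
            [/\ 0 < a.2, -1 < b.2 & c.2 = m.+1%:R + 1 + a.2 + b.2].

Lemma bounded_kerS : bounded_Linf mu (@kerS R m.+1 a b c) <-> cond.
Proof.
have KE p q : D p -> D q -> @kerS R m.+1 a b c p q =
    (skernel a b c p q)%:C%C * Complex (cos ((cst 0 : P * P -> R) (p, q)))
                                       (sin ((cst 0 : P * P -> R) (p, q))).
  by move=> _ _; rewrite /cst cos0 sin0 [Complex 1 0](_ : _ = 1)// mulr1.
have mth : measurable_fun (D `*` D) (cst 0 : P * P -> R) by exact: measurable_cst.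
split.
  apply: (phase_kernel_necessary mul KE) => p q _ _.
  by rewrite normr0 addr_ge0// mulr_ge0.
by move=> [h1 h2]; exact: (phase_kernel_bounded mul KE mth).
Qed.

Lemma bounded_kerT : bounded_Linf mu (@kerT R m.+1 a b c) <-> cond.
Proof.
(* The sign is negative because the complex powers stand in the denominator. *)
pose th (x : P * P) := - (c.1 * Arg (rho2 x.1.1 x.2.1) + c.2 * Arg (rho2 x.1.2 x.2.2)).
have KE p q : D p -> D q -> @kerT R m.+1 a b c p q =
    (skernel a b c p q)%:C%C * Complex (cos (th (p, q))) (sin (th (p, q))).
  move=> [p1 p2] [q1 q2].
  have w1 := cabs_gt0 (Re_rho2_gt0 p1 q1); have w2 := cabs_gt0 (Re_rho2_gt0 p2 q2).
  by rewrite /kerT !cpow_polar// div_polar ?powR_gt0.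
have mth : measurable_fun (D `*` D) th.
  apply: measurableT_comp => //; apply: measurable_funD; apply: measurable_funM => //.
    apply: (@measurable_Arg_rho2 (fun x => (x.1.1, x.2.1))).
      by apply: measurable_fun_pair; exact: measurableT_comp.
    by move=> x [[? _] [? _]].
  apply: (@measurable_Arg_rho2 (fun x => (x.1.2, x.2.2))).
    by apply: measurable_fun_pair; exact: measurableT_comp.
  by move=> x [[_ ?] [_ ?]].
split.
  apply: (phase_kernel_necessary mul KE) => p q _ _.
  by rewrite /th normrN (le_trans (ler_normD _ _))// !normrM.
by move=> [h1 h2]; exact: (phase_kernel_bounded mul KE mth).
Qed.

End phases.

Theorem theorem6p9 (R : realType) (n : nat) (n_gt0 : (0 < n)%N)
  (mu : {sigma_finite_measure set Cn R n -> \bar R})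
  (mu_leb : is_lebesgue mu) (a b c : R * R) :
  (bounded_Linf mu (@kerS R n a b c) <-> bounded_Linf mu (@kerT R n a b c)) /\
  (bounded_Linf mu (@kerT R n a b c) <->
    [/\ 0 < a.1, -1 < b.1 & c.1 = n%:R + 1 + a.1 + b.1] /\
    [/\ 0 < a.2, -1 < b.2 & c.2 = n%:R + 1 + a.2 + b.2]).
Proof.
case: n n_gt0 mu mu_leb => // m _ mu mul.
by rewrite bounded_kerS// bounded_kerT.
Qed.
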